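(* Let $f:\mathcal C\to\mathbb R^n$ be Lipschitz on bounded sets with $f(0)=0$, and let $\mathcal D:\mathcal C\to\mathbb R^n$, $\mathcal D\phi=\phi(0)-\sum_{j=1}^pA_j\phi(-\Delta_j)$, be strongly stable. The system described by $$\frac{d}{dt}\mathcal Dx_t=f(x_t),\quad t\ge 0,\qquad x(\tau)=\xi_0(\tau),\ \tau\in[-\Delta,0],\ \xi_0\in\mathcal C,$$ is $0$-GAS if and only if there exist a locally Lipschitz functional $V:\mathcal C\to\mathbb R^+$, functions $\alpha_1,\alpha_2$ of class $\mathcal K_\infty$, and a function $\alpha_3$ of class $\mathcal K$ such that the following conditions hold for all $\phi\in\mathcal C$: (i) $\alpha_1(|\mathcal D\phi|)\le V(\phi)\le\alpha_2(\|\phi\|)$; (ii) $D^+V(\phi)\le-\alpha_3(|\mathcal D\phi|)$.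
   Context: Notation. $\mathbb R^+=[0,+\infty)$; $|\cdot|$ is the Euclidean norm on $\mathbb R^n$; $n,p$ are positive integers; $\Delta>0$ is real; $0<\Delta_j\le\Delta$ are reals and $A_j\in\mathbb R^{n\times n}$, $j=1,\dots,p$. $\mathcal C$ is the Banach space of continuous functions $[-\Delta,0]\to\mathbb R^n$ with the supremum norm $\|\cdot\|$; $\mathcal C_H=\{\psi\in\mathcal C:\|\psi\|\le H\}$. For a function $x$ on $[-\Delta,c)$ and $t\in[0,c)$, $x_t\in\mathcal C$ is $x_t(\tau)=x(t+\tau)$, $\tau\in[-\Delta,0]$. A solution on $[0,b)$ is a continuous $x:[-\Delta,b)\to\mathbb R^n$ with $x_0=\xi_0$ such that $t\mapsto\mathcal Dx_t$ is continuously differentiable and satisfies the equation (one-sided derivative at $t=0$). Strong stability. $\mathcal D$ is strongly stable (Hale and Lunel) if for every choice of positive delays $r_1,\dots,r_p$ the zero solution of the difference equation $y(t)=\sum_{j=1}^pA_jy(t-r_j)$ is uniformly asymptotically stable; equivalently, $\sup\{\rho(\sum_{j=1}^pA_je^{i\theta_j}):\theta_j\in[0,2\pi]\}<1$, where $\rho$ is the spectral radius. Lipschitz notions. A map $Q$ on $\mathcal C$ is locally Lipschitz if for every $\phi\in\mathcal C$ there are $H,L>0$ with $|Q(\phi_1)-Q(\phi_2)|\le L\|\phi_1-\phi_2\|$ whenever $\|\phi_i-\phi\|\le H$, $i=1,2$; it is Lipschitz on bounded sets if for every $H>0$ there is $L>0$ such that this inequality holds for all $\phi_1,\phi_2\in\mathcal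 C_H$. Comparison functions. A function $\gamma:\mathbb R^+\to\mathbb R^+$ is of class $\mathcal K$ if it is continuous, zero at zero and strictly increasing; of class $\mathcal K_\infty$ if it is moreover unbounded. 0-GAS. The system is $0$-GAS if: (i) for any $\epsilon>0$ there exists $\delta>0$ such that, for any $\xi_0\in\mathcal C_\delta$, the solution exists for all $t\in\mathbb R^+$ and satisfies $|x(t)|<\epsilon$ for all $t\ge0$; moreover, $\delta$ can be chosen arbitrarily large for sufficiently large $\epsilon$; (ii) for any $H>0$ and any $\epsilon>0$ there exists $T>0$ such that, for any $\xi_0\in\mathcal C_H$, the solution exists for all $t\in\mathbb R^+$ and satisfies $|x(t)|<\epsilon$ for all $t\ge T$. Derivative. For locally Lipschitz $V:\mathcal C\to\mathbb R^+$, $D^+V:\mathcal C\to[-\infty,+\infty]$ is $$D^+V(\phi)=\limsup_{h\to0^+}\frac{V(\phi_h)-V(\phi)}{h},$$ where, for $0<h<\Delta$, $\phi_h\in\mathcal C$ is given by $\phi_h(s)=\phi(s+h)$ for $s\in[-\Delta,-h]$ and $\phi_h(s)=\mathcal D\phi+f(\phi)(s+h)-\mathcal D\phi^\star_{s+h}+\phi(0)$ for $s\in(-h,0]$; and, for $0<\theta\le h$, $\phi^\star_\theta\in\mathcal C$ is given by $\phi^\star_\theta(s)=\phi(s+\theta)$ for $s\in[-\Delta,-\theta]$ and $\phi^\star_\theta(s)=\phi(0)$ for $s\in(-\theta,0]$. *)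

(* Defs.v *)
From HB Require Import structures.
From mathcomp Require Import all_boot all_order all_algebra.
From mathcomp Require Import all_classical all_reals all_analysis.
From mathcomp Require Import lra.

Set Implicit Arguments.
Unset Strict Implicit.
Unset Printing Implicit Defensive.

Import Order.TTheory GRing.Theory Num.Theory.
Import numFieldNormedType.Exports.

Local Open Scope classical_set_scope.
Local Open Scope ring_scope.

(* The library norm on matrices is the max norm, hence this definition; both
   norms induce the same topology, so limits and continuity in ['cV[R]_n] are
   taken from the library. *)
Definition enorm (R : realType) (n : nat) (v : 'cV[R]_n) : R :=
  Num.sqrt (\sum_(i < n) v i 0 ^+ 2).

(* Meaningful when [g] is continuous on [-r, 0], so that the set is bounded. *)
Definition supnorm (R : realType) (n : nat) (r : R) (g : R -> 'cV[R]_n) : R :=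
  sup [set enorm (g s) | s in `[- r, 0]].

(* The space of continuous functions [-Delta, 0] -> R^n. Functions are total in
   Rocq, so each element is represented by its extension by 0 outside of
   [-Delta, 0]; [hist_ext] shows that this representation is unique. *)
Record hist (R : realType) (n : nat) (Delta : R) := Hist {
  hist_fun :> R -> 'cV[R]_n ;
  hist_continuous : {within `[- Delta, 0], continuous hist_fun} ;
  hist_outside : forall s, ~ `[- Delta, 0]%classic s -> hist_fun s = 0 }.

Lemma hist_ext (R : realType) (n : nat) (Delta : R) (phi psi : hist n Delta) :
  (forall s, `[- Delta, 0]%classic s -> phi s = psi s) -> phi = psi.
Proof.
move=> E; have {}E : hist_fun phi = hist_fun psi.
  apply/funext => s; have [/E//|ns] := pselect (`[- Delta, 0]%classic s).
  by rewrite !hist_outside.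
case: phi psi E => [f cf zf] [g cg zg] /= E; subst g.
by rewrite (Prop_irrelevance cf cg) (Prop_irrelevance zf zg).
Qed.

Lemma patch_continuous (R : realType) (n : nat) (Delta : R)
    (g : R -> 'cV[R]_n) : {within `[- Delta, 0], continuous g} ->
  {within `[- Delta, 0], continuous (patch (fun=> 0) `[- Delta, 0] g)}.
Proof.
apply: subspace_eq_continuous => s sD.
by rewrite /from_subspace/= /patch; case: ifPn => // /negP[].
Qed.

Lemma patch_outside (R : realType) (n : nat) (Delta : R) (g : R -> 'cV[R]_n)
    (s : R) : ~ `[- Delta, 0]%classic s ->
  patch (fun=> 0) `[- Delta, 0] g s = 0.
Proof. by move=> ns; rewrite /patch; case: ifPn => // /set_mem /ns. Qed.

Lemma zero_continuous (R : realType) (n : nat) (Delta : R) :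
  {within `[- Delta, 0], continuous (fun _ : R => 0 : 'cV[R]_n)}.
Proof. by move=> ?; exact: cst_continuous. Qed.

Definition hist0 (R : realType) (n : nat) (Delta : R) : hist n Delta :=
  Hist (@zero_continuous R n Delta) (fun _ _ => erefl).

(* The restriction of [g] to [-Delta, 0]; the default value [hist0] is only
   reached when this restriction is not continuous. This never happens for the
   functions used below: see [segmentE], [frozen_shiftE], [neutral_shiftE]. *)
Definition restr (R : realType) (n : nat) (Delta : R) (g : R -> 'cV[R]_n) :
    hist n Delta :=
  match pselect {within `[- Delta, 0], continuous g} with
  | left cg => Hist (patch_continuous cg) (patch_outside g)
  | right _ => hist0 n Delta
  end.

Lemma restrE (R : realType) (n : nat) (Delta : R) (g : R -> 'cV[R]_n) (s : R) :
  {within `[- Delta, 0], continuous g} -> `[- Delta, 0]%classic s ->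
  restr Delta g s = g s.
Proof.
move=> cg sD; rewrite /restr; case: pselect => //= _.
by rewrite /patch; case: ifPn => // /negP[]; exact: mem_set.
Qed.

Definition segment (R : realType) (n : nat) (Delta : R) (x : R -> 'cV[R]_n)
    (t : R) : hist n Delta := restr Delta (fun tau => x (t + tau)).

Definition neutral_op (R : realType) (n p : nat) (Delta : R)
    (A : 'I_p -> 'M[R]_n) (delay : 'I_p -> R) (phi : hist n Delta) : 'cV[R]_n :=
  phi 0 - \sum_(j < p) A j *m phi (- delay j).

Definition max_delay (R : realType) (p : nat) (r : 'I_p -> R) : R :=
  \big[Num.max/0]_(j < p) r j.

Definition difference_solution (R : realType) (n p : nat)
    (A : 'I_p -> 'M[R]_n) (r : 'I_p -> R) (t0 : R) (y : R -> 'cV[R]_n) : Prop :=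
  {within `[t0 - max_delay r, +oo[, continuous y} /\
  forall t, t0 <= t -> y t = \sum_(j < p) A j *m y (t - r j).

(* Uniform asymptotic stability of the zero solution, in the space of
   continuous solutions of Hale and Lunel: continuity at [t0] forces the initial
   function to satisfy the equation at [t0]. Uniformity is with respect to the
   initial time [t0]. *)
Definition difference_uas (R : realType) (n p : nat)
    (A : 'I_p -> 'M[R]_n) (r : 'I_p -> R) : Prop :=
  let init_norm t0 y := supnorm (max_delay r) (fun tau => y (t0 + tau)) in
  (forall eps : R, 0 < eps -> exists2 delta : R, 0 < delta &
     forall t0 y, difference_solution A r t0 y -> init_norm t0 y <= delta ->
     forall t, t0 <= t -> enorm (y t) < eps) /\
  (exists2 b : R, 0 < b &
     forall eps : R, 0 < eps -> exists2 T : R, 0 < T &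
     forall t0 y, difference_solution A r t0 y -> init_norm t0 y <= b ->
     forall t, t0 + T <= t -> enorm (y t) < eps).

Definition strongly_stable (R : realType) (n p : nat) (A : 'I_p -> 'M[R]_n) :
    Prop :=
  forall r : 'I_p -> R, (forall j, 0 < r j) -> difference_uas A r.

Definition lipschitz_on_bounded_sets (R : realType) (n : nat) (Delta : R)
    (Q : hist n Delta -> 'cV[R]_n) : Prop :=
  forall H : R, 0 < H -> exists2 L : R, 0 < L &
  forall phi1 phi2 : hist n Delta,
    supnorm Delta phi1 <= H -> supnorm Delta phi2 <= H ->
    enorm (Q phi1 - Q phi2) <= L * supnorm Delta (phi1 \- phi2).

Definition locally_lipschitz (R : realType) (n : nat) (Delta : R)
    (V : hist n Delta -> R) : Prop :=
  forall phi : hist n Delta, exists H L : R, [/\ 0 < H, 0 < L &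
  forall phi1 phi2 : hist n Delta,
    supnorm Delta (phi1 \- phi) <= H -> supnorm Delta (phi2 \- phi) <= H ->
    `|V phi1 - V phi2| <= L * supnorm Delta (phi1 \- phi2)].

(* Functions R^+ -> R^+ are represented by functions on [R], constrained on
   [0, +oo[ only. *)
Definition class_K (R : realType) (gamma : R -> R) : Prop :=
  [/\ forall s, 0 <= s -> 0 <= gamma s,
      {within `[0, +oo[, continuous gamma},
      gamma 0 = 0 &
      forall s t, 0 <= s -> s < t -> gamma s < gamma t].

Definition class_Kinf (R : realType) (gamma : R -> R) : Prop :=
  class_K gamma /\ forall M : R, exists2 s : R, 0 <= s & M < gamma s.

(* Solution on [0, +oo): only the values of [x] on [-Delta, +oo[ matter. The
   limit within [0, +oo[ is the two-sided derivative at t > 0 and the right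
   derivative at t = 0. *)
Definition global_solution (R : realType) (n p : nat) (Delta : R)
    (A : 'I_p -> 'M[R]_n) (delay : 'I_p -> R) (f : hist n Delta -> 'cV[R]_n)
    (xi0 : hist n Delta) (x : R -> 'cV[R]_n) : Prop :=
  let Dx t := neutral_op A delay (segment Delta x t) in
  [/\ {within `[- Delta, +oo[, continuous x},
      forall tau, - Delta <= tau <= 0 -> x tau = xi0 tau &
      exists2 dDx : R -> 'cV[R]_n, {within `[0, +oo[, continuous dDx} &
      forall t, 0 <= t ->
        (s - t)^-1 *: (Dx s - Dx t) @[s --> within `[0, +oo[ t^'] --> dDx t /\
        dDx t = f (segment Delta x t)].

(* "The solution exists for all t >= 0 and satisfies [P]". *)
Definition solution_satisfies (R : realType) (n p : nat) (Delta : R)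
    (A : 'I_p -> 'M[R]_n) (delay : 'I_p -> R) (f : hist n Delta -> 'cV[R]_n)
    (xi0 : hist n Delta) (P : (R -> 'cV[R]_n) -> Prop) : Prop :=
  (exists x, global_solution A delay f xi0 x) /\
  (forall x, global_solution A delay f xi0 x -> P x).

(* The second conjunct is the requirement that delta can be chosen arbitrarily
   large for sufficiently large eps. *)
Definition zero_GAS (R : realType) (n p : nat) (Delta : R)
    (A : 'I_p -> 'M[R]_n) (delay : 'I_p -> R) (f : hist n Delta -> 'cV[R]_n) :
    Prop :=
  let stable_for eps delta := forall xi0 : hist n Delta,
    supnorm Delta xi0 <= delta ->
    solution_satisfies A delay f xi0
      (fun x => forall t, 0 <= t -> enorm (x t) < eps) in
  [/\ forall eps : R, 0 < eps -> exists2 delta : R, 0 < delta &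
        stable_for eps delta,
      forall M : R, exists2 eps0 : R, 0 < eps0 &
        forall eps, eps0 <= eps -> exists2 delta, M <= delta &
        stable_for eps delta &
      forall H eps : R, 0 < H -> 0 < eps -> exists2 T : R, 0 < T &
        forall xi0 : hist n Delta, supnorm Delta xi0 <= H ->
        solution_satisfies A delay f xi0
          (fun x => forall t, T <= t -> enorm (x t) < eps)].

(* phi is shifted to the left by [theta] and continued by the constant phi(0). *)
Definition frozen_shift (R : realType) (n : nat) (Delta : R)
    (phi : hist n Delta) (theta : R) : hist n Delta :=
  restr Delta (fun s => if s <= - theta then phi (s + theta) else phi 0).

(* phi is shifted to the left by [h] and continued in such a way that, when [h]
   does not exceed the delays, the neutral operator evaluated along the
   continuation is affine with slope [f phi]. *)
Definition neutral_shift (R : realType) (n p : nat) (Delta : R)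
    (A : 'I_p -> 'M[R]_n) (delay : 'I_p -> R) (f : hist n Delta -> 'cV[R]_n)
    (phi : hist n Delta) (h : R) : hist n Delta :=
  restr Delta (fun s =>
    if s <= - h then phi (s + h)
    else neutral_op A delay phi + (s + h) *: f phi
         - neutral_op A delay (frozen_shift phi (s + h)) + phi 0).

Definition upper_derivative (R : realType) (n p : nat) (Delta : R)
    (A : 'I_p -> 'M[R]_n) (delay : 'I_p -> R) (f : hist n Delta -> 'cV[R]_n)
    (V : hist n Delta -> R) (phi : hist n Delta) : \bar R :=
  limf_esup (fun h => ((V (neutral_shift A delay f phi h) - V phi) / h)%:E)
            (0 : R)^'+.

Lemma hist_clamp_continuous (R : realType) (n : nat) (Delta : R)
    (phi : hist n Delta) : 0 < Delta ->
  continuous (fun s : R => phi (Num.max (- Delta) (Num.min s 0))).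
Proof.
move=> D0 s.
have /subspace_continuousP cphi := @hist_continuous _ _ _ phi.
have cl (u : R) : `[- Delta, 0]%classic (Num.max (- Delta) (Num.min u 0)).
  by rewrite /= in_itv/= le_max lexx/= ge_max ge_min lexx orbT andbT; lra.
apply: cvg_trans (cphi _ (cl s)).
pose c (u : R) : R := Num.max (- Delta) (Num.min u 0).
suff: c u @[u --> s] --> within `[- Delta, 0] (nbhs (c s)).
  by move=> h; exact: (cvg_app (hist_fun phi) h).
have h : c u @[u --> s] --> nbhs (c s).
  apply: (@continuous_max R R (fun=> - Delta) (fun u => Num.min u 0) s).
    exact: cvg_cst.
  by apply: (@continuous_min R R id (fun=> 0) s); [exact: cvg_id|exact: cvg_cst].
move=> B hB; have hB' : nbhs s (c @^-1` (fun v => `[- Delta, 0]%classic v -> B v)).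
  exact: (h _ hB).
change (nbhs s (c @^-1` B)).
move: hB'; apply: filterS => u /= huB.
exact: huB (cl u).
Qed.

Lemma mulmxl_continuous (R : realType) (n : nat) (A : 'M[R]_n) :
  continuous (fun v : 'cV[R]_n => A *m v).
Proof.
have -> : (fun v : 'cV[R]_n => A *m v) =
    (fun v => \sum_(j < n) v j 0 *: col j A).
  apply/funext => v; apply/matrixP => i j; rewrite !mxE summxE ord1.
  by apply: eq_bigr => k _; rewrite !mxE mulrC.
apply: (@continuous_big 'cV[R]_n _ +%R 0 xpredT) => [|j _ v].
  exact: add_continuous.
by apply: (@cvgZr_tmp _ _ _ (nbhs v)); exact: coord_continuous.
Qed.

Lemma segmentE (R : realType) (n : nat) (Delta : R) (x : R -> 'cV[R]_n)
    (t tau : R) : {within `[- Delta, +oo[, continuous x} -> 0 <= t ->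
  - Delta <= tau <= 0 -> segment Delta x t tau = x (t + tau).
Proof.
move=> /subspace_continuousP cx t0 tauD; rewrite restrE//=.
apply/subspace_continuousP => s; rewrite /= in_itv/= => /andP[sD _].
apply: cvg_trans (cx (t + s) _); last by rewrite /= in_itv/= andbT; lra.
suff h : (t + u) @[u --> within `[- Delta, 0] (nbhs s)] -->
    within `[- Delta, +oo[ (nbhs (t + s)) by exact: (cvg_app x h).
have h : (t + u) @[u --> s] --> nbhs (t + s).
  by apply: cvgD; [exact: cvg_cst|exact: cvg_id].
move=> B hB; have hB' : nbhs s ((fun u => t + u) @^-1` (fun v => `[- Delta, +oo[%classic v -> B v)).
  exact: (h _ hB).
change (nbhs s ((fun u => `[- Delta, 0]%classic u -> B (t + u)))).
move: hB'; apply: filterS => u /= huB.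
by rewrite in_itv/= => uD; apply: huB; rewrite in_itv/= andbT; lra.
Qed.

Lemma frozen_shiftE (R : realType) (n : nat) (Delta : R) (phi : hist n Delta)
    (theta s : R) : 0 < Delta -> 0 <= theta -> - Delta <= s <= 0 ->
  frozen_shift phi theta s = if s <= - theta then phi (s + theta) else phi 0.
Proof.
move=> D0 theta0 sD; rewrite restrE//.
have cphi := hist_clamp_continuous (phi := phi) D0.
apply: (@subspace_eq_continuous _ _ _
  (fun s => phi (Num.max (- Delta) (Num.min (s + theta) 0)))).
  move=> /= u; rewrite inE/= in_itv/= /from_subspace => uD.
  case: (leP u (- theta)) => uth.
    by rewrite (@min_l _ R) ?(@max_r _ R)//; lra.
  by rewrite (@min_r _ R) ?(@max_r _ R)//; lra.
apply: continuous_subspaceT => u.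
apply: (@continuous_comp _ _ _ (fun u => u + theta) _ u _ (cphi _)).
by apply: cvgD; [exact: cvg_id|exact: cvg_cst].
Qed.

Lemma neutral_shiftE (R : realType) (n p : nat) (Delta : R)
    (A : 'I_p -> 'M[R]_n) (delay : 'I_p -> R) (f : hist n Delta -> 'cV[R]_n)
    (phi : hist n Delta) (h s : R) :
  (forall j, 0 < delay j <= Delta) -> 0 < h < Delta -> - Delta <= s <= 0 ->
  neutral_shift A delay f phi h s =
    if s <= - h then phi (s + h)
    else neutral_op A delay phi + (s + h) *: f phi
         - neutral_op A delay (frozen_shift phi (s + h)) + phi 0.
Proof.
move=> hdelay hD sD; rewrite restrE//.
have D0 : 0 < Delta by lra.
pose c (u : R) : R := Num.max (- Delta) (Num.min u 0).
have cphi : continuous (phi \o c) := hist_clamp_continuous D0.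
pose m (u : R) : R := Num.max (u + h) 0.
pose g (u : R) : 'cV[R]_n := (phi \o c) (u + h) + m u *: f phi
  + \sum_(j < p) A j *m ((phi \o c) (m u - delay j) - phi (- delay j)).
have cE (u : R) : - Delta <= u <= 0 -> c u = u.
  by move=> uD; rewrite /c min_l ?max_r//; lra.
have c0 (u : R) : 0 <= u -> c u = 0.
  by move=> uD; rewrite /c min_r ?max_r//; lra.
have cadd : forall v : R, (u + h) @[u --> v] --> v + h.
  by move=> v; apply: cvgD; [exact: cvg_id|exact: cvg_cst].
have cm : continuous m.
  by move=> v; apply: (@continuous_max R R (fun u => u + h) (fun=> 0) v);
     [exact: cadd|exact: cvg_cst].
apply: (@subspace_eq_continuous _ _ _ g).
  move=> /= u; rewrite inE/= in_itv/= /from_subspace => uD; rewrite /g/=.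
  case: (leP u (- h)) => uh.
    have -> : m u = 0 by rewrite /m max_r//; lra.
    rewrite cE; last lra.
    rewrite scale0r addr0 big1 ?addr0// => j _.
    by have := hdelay j => dj; rewrite sub0r cE ?subrr ?mulmx0//; lra.
  have mE : m u = u + h by rewrite /m max_l//; lra.
  rewrite mE c0; last lra.
  rewrite /neutral_op (frozen_shiftE _ D0); [|lra|lra].
  have -> : (0 <= - (u + h)) = false by lra.
  have -> : \sum_(j < p) A j *m frozen_shift phi (u + h) (- delay j) =
      \sum_(j < p) A j *m (phi (c (u + h - delay j))).
    apply: eq_bigr => j _; have := hdelay j => dj; congr (_ *m _).
    rewrite (frozen_shiftE _ D0); [|lra|lra].
    case: leP => hj; first by rewrite cE; [congr (phi _); lra|lra].
    by rewrite c0//; lra.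
  under eq_bigr do rewrite mulmxBr.
  rewrite sumrB; set a := phi 0; set X := \sum_(i < p) _; set Y := \sum_(i < p) _.
  by rewrite opprB; set F := _ *: _; apply/matrixP => i j; rewrite !mxE; lra.
apply: continuous_subspaceT => u; rewrite /g.
apply: cvgD; first apply: cvgD.
- exact: (continuous_comp (cadd u) (cphi _)).
- by apply: cvgZr_tmp; exact: cm.
- move: u; apply: (@continuous_big 'cV[R]_n _ +%R 0 xpredT) => [|j _ u].
    exact: add_continuous.
  apply: (@continuous_comp _ _ _
    (fun u => (phi \o c) (m u - delay j) - phi (- delay j)) _ u
    _ (@mulmxl_continuous _ _ _ _)).
  apply: cvgB; last exact: cvg_cst.
  apply: (@continuous_comp _ _ _ (fun u => m u - delay j) _ u _ (cphi _)).
  by apply: cvgB; [exact: cm|exact: cvg_cst].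
Qed.

(* Main.v *)
Require Import Defs.
From HB Require Import structures.
From mathcomp Require Import all_boot all_order all_algebra.
From mathcomp Require Import all_classical all_reals all_analysis.
From mathcomp Require Import lra ring.

(* Idea. Write D x_t for the neutral difference along x. A solution is handled
   through the right derivative of t |-> D x_t alone, so that every estimate
   reduces to one comparison principle for upper right Dini derivatives.

   Sufficiency. The given V is nonincreasing along solutions, because the shift
   phi_h of the definition of D^+V agrees with the solution up to o(h). This
   bounds D x_t, and stability of the difference operator turns a bound on D x_t
   into a bound on x: over a long enough window the homogeneous part is halved.
   The a priori bound makes solutions global (truncate f outside of a ball and
   solve the truncated equation by Picard iteration in an exponentially weighted
   norm). Attraction holds since on each long window either D x_t is
   small throughout, so that x becomes small, or V drops by a fixed amount.

   Necessity. The functional is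
     V phi = sup over k and t >= - Delta of
               c_k e^t max(0, |x(t, phi)| - 1/(k+1)).
   The factor e^t yields D^+V <= - V, uniform attraction makes each t-supremum
   range over a compact time interval, where solutions depend in a Lipschitz way
   on their data, and small c_k make the supremum over k locally Lipschitz. *)

Set Implicit Arguments.
Unset Strict Implicit.
Unset Printing Implicit Defensive.

Import Order.TTheory GRing.Theory Num.Theory.
Import numFieldNormedType.Exports.

Local Open Scope classical_set_scope.
Local Open Scope ring_scope.

(** * Comparison by Dini derivatives *)

(** The neutral term is the obstacle: a solution [x] need not be differentiable, and smallness of
    [D x_t] does not by itself make [x] small. Estimates on [x] therefore go either by steps no
    longer than the smallest delay [r], on which the delayed terms are already known, or through the
    difference equation with [D x_t] as input. The same [r] makes the shift of [upper_derivative]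
    agree with the solution to first order. In the converse functional the threshold [1/(k+1)] is
    there because attraction comes without a rate: [e^t |x(t)|] alone could be unbounded, whereas
    the excess over the threshold vanishes after a time that is uniform on balls. Since D^+V <= - V,
    one function serves as both [alpha1] and [alpha3]. *)

Lemma real_ind (R : realType) (a : R) (P : R -> Prop) : P a ->
  (forall t, a <= t -> (forall s, a <= s <= t -> P s) ->
     exists2 d, 0 < d & forall s, t < s < t + d -> P s) ->
  (forall t, a < t -> (forall s, a <= s < t -> P s) -> P t) ->
  forall t, a <= t -> P t.
Proof.
move=> Pa Pright Pleft b ab; apply: contrapT => nPb.
pose S := [set t | a <= t /\ forall s, a <= s <= t -> P s].
have Sa : S a by split=> // s sa; have -> : s = a by lra.
have ubS : ubound S b.
  move=> t [at_ St]; case: (leP t b) => // bt; case: nPb; apply: St; lra.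
have hS : has_sup S by split; [exists a|exists b].
have am : a <= sup S by apply: ub_le_sup Sa; exists b.
have Pm s : a <= s < sup S -> P s.
  move=> /andP[as_ sm]; have [t [_ St] st] := @sup_gt _ S _ (ex_intro _ a Sa)
    sm.
  by apply: St; lra.
have Psup : P (sup S).
  have [am'|am'] := ltP a (sup S); first exact: Pleft.
  by have -> : sup S = a by lra.
have Pm' s : a <= s <= sup S -> P s.
  move=> h; have [->//|ns] := eqVneq s (sup S).
  by apply: Pm; rewrite lt_neqAle ns; lra.
have [d d0 Pd] := Pright _ am Pm'.
have : S (sup S + d / 2).
  split; [lra|move=> s hs; have [sm|ms] := leP s (sup S); first by apply: Pm';
    lra].
  by apply: Pd; lra.
move=> /(ub_le_sup (ex_intro _ b ubS)); lra.
Qed.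

Lemma continuous_epsdelta (R : realType) (V : normedModType R) (g : R -> V) :
  continuous g <-> forall t e, 0 < e -> exists2 d, 0 < d &
    forall u, `|u - t| < d -> `|g u - g t| < e.
Proof.
split=> [cg t e e0|cg t].
  have /cvgrPdist_lt/(_ e e0)/nbhs_ballP[d /= d0 hd] := cg t.
  exists d => // u ut; rewrite distrC; apply: hd.
  by rewrite /ball /= distrC.
apply/cvgrPdist_lt => e e0; have [d d0 hd] := cg t e e0.
apply/nbhs_ballP; exists d => //= u; rewrite /ball /= => ut.
by rewrite distrC; apply: hd; rewrite distrC.
Qed.

Lemma le_of_forall_eps (R : realType) (x y k : R) : 0 <= k ->
  (forall e, 0 < e -> x <= y + e * k) -> x <= y.
Proof.
move=> k0 h; have [//|yx] := leP x y.
have k1 : 0 < 1 + k by lra.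
pose e := (x - y) / (1 + k).
have ek : e * (1 + k) = x - y by rewrite /e divfK// gt_eqF.
have e0 : 0 < e by apply: divr_gt0 => //; lra.
have := h e e0; lra.
Qed.

(** Continuous induction on the bound with slope [c + e]: the right-hand estimate extends it past
    [t], continuity closes it at left limits, and [e] is sent to 0 at the end. *)
Lemma dini_le (R : realType) (v : R -> R) (a b c : R) : continuous v -> a <= b
  ->
  (forall t, a <= t < b -> forall e, 0 < e -> exists2 d, 0 < d &
     forall h, 0 < h < d -> v (t + h) <= v t + (c + e) * h) ->
  v b <= v a + c * (b - a).
Proof.
move=> /continuous_epsdelta cv ab dv.
apply: (@le_of_forall_eps _ _ _ (b - a)); first lra.
move=> e e0.
suff H t : a <= t -> t <= b -> v t <= v a + (c + e) * (t - a).
  by have := H b ab (lexx _); lra.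
move: t; apply: real_ind => [_|t at_ IH|t at_ IH tb].
- lra.
- have [tb|bt] := ltP t b; last first.
    by exists 1 => // s st sb; lra.
  have [|d d0 hd] := dv t _ e e0; first lra.
  exists d => // s st sb; have := IH t.
  have := hd (s - t); have -> : t + (s - t) = s by lra.
  move=> /(_ ltac:(lra)) h1 /(_ ltac:(lra) ltac:(lra)) h2; lra.
- apply: (@le_of_forall_eps _ _ _ (1 + `|c + e|));
    first by have := normr_ge0 (c + e); lra.
  move=> e' e'0; have [d d0 hd] := cv t e' e'0.
  (* A point below [t], close enough for continuity and within [e' / 2], so that the affine bound
     changes by at most [|c + e| * e']. *)
  pose s := Num.max a (t - Num.min e' d / 2).
  have m0 : 0 < Num.min e' d by rewrite lt_min e'0 d0.
  have m1 : Num.min e' d <= e' by rewrite ge_min lexx.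
  have m2 : Num.min e' d <= d by rewrite ge_min lexx orbT.
  have sa : a <= s by rewrite le_max lexx.
  have s2 : t - Num.min e' d / 2 <= s by rewrite le_max lexx orbT.
  have st : s < t by rewrite gt_max; apply/andP; split; lra.
  have := IH s ltac:(lra) ltac:(lra); have := hd s.
  rewrite distrC ger0_norm; last lra.
  move=> /(_ ltac:(lra)); rewrite ltr_norml => /andP[h1 h2] h3.
  have h4 : (c + e) * (s - t) <= `|c + e| * e'.
    rewrite (le_trans (ler_norm _))// normrM ler_wpM2l//.
    by rewrite distrC ger0_norm; lra.
  lra.
Qed.

Lemma continuous_normr (R : realType) (V : normedModType R) (g : R -> V) :
  continuous g -> continuous (fun t => `|g t| : R).
Proof. by move=> cg t; apply: cvg_norm; exact: cg. Qed.

Lemma dini_norm_le (R : realType) (V : normedModType R) (g : R -> V)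
    (a b c : R) : continuous g -> a <= b ->
  (forall t, a <= t < b -> forall e, 0 < e -> exists2 d, 0 < d &
     forall h, 0 < h < d -> `|g (t + h) - g t| <= (c + e) * h) ->
  `|g b - g a| <= c * (b - a).
Proof.
move=> cg ab dg.
have := @dini_le _ (fun t => `|g t - g a|) a b c.
rewrite subrr normr0 add0r; apply => //.
  apply: continuous_normr => t; apply: cvgB; [exact: cg|exact: cvg_cst].
move=> t tab e e0; have [d d0 hd] := dg t tab e e0; exists d => // h hh.
by have := ler_distD (g t) (g (t + h)) (g a); have := hd h hh; lra.
Qed.

(** Continuous induction replaces a covering argument. Only [u] is confined to the interval; [v] may
    leave it, as happens in [sg_continuous] when a window is shifted past its ends. *)
Lemma unif_continuous_itv (R : realType) (V : normedModType R) (g : R -> V)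
    (a b e : R) : continuous g -> 0 < e -> exists2 d, 0 < d &
  forall u v, a <= u <= b -> `|v - u| < d -> `|g v - g u| <= e.
Proof.
move=> /continuous_epsdelta cg e0; have [ab|ba] := leP a b; last first.
  by exists 1 => // u v; lra.
have loc s : exists2 d, 0 < d & forall u v, `|u - s| < d -> `|v - u| < d ->
    `|g v - g u| <= e.
  have [d d0 hd] := cg s (e / 2) ltac:(lra).
  exists (d / 2); first lra.
  move=> u v us vu.
  have h1 := hd u ltac:(lra); have h2 : `|g v - g s| < e / 2.
    by apply: hd; have := ler_distD u v s; lra.
  by have := ler_distD (g s) (g v) (g u); rewrite (distrC (g s)); lra.
pose P s := s <= b -> exists2 d, 0 < d & forall u v, a <= u <= s ->
  `|v - u| < d -> `|g v - g u| <= e.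
suff : P b by exact.
apply: (@real_ind _ a P) => //.
- move=> _; have [d d0 hd] := loc a; exists d => // u v us.
  have -> : u = a by lra.
  by apply: hd; rewrite subrr normr0.
- move=> t at_ IH; have [tb|bt] := leP t b; last first.
    by exists 1 => // s st sb; lra.
  have [d d0 hd] := IH t ltac:(lra) tb; have [d' d'0 hd'] := loc t.
  exists d' => // s st sb; exists (Num.min d d'); first by rewrite lt_min d0.
  move=> u v us; rewrite lt_min => /andP[vd vd'].
  have [ut|tu] := leP u t; first by apply: hd => //; lra.
  by apply: hd' => //; rewrite ger0_norm; lra.
- move=> t at_ IH tb; have [d' d'0 hd'] := loc t.
  pose s := Num.max a (t - d' / 2).
  have sa : a <= s by rewrite le_max lexx.
  have s2 : t - d' / 2 <= s by rewrite le_max lexx orbT.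
  have st : s < t by rewrite gt_max; apply/andP; split; lra.
  have [d d0 hd] := IH s ltac:(lra) ltac:(lra).
  exists (Num.min d d'); first by rewrite lt_min d0.
  move=> u v us; rewrite lt_min => /andP[vd vd'].
  have [ut|tu] := leP u s; first by apply: hd => //; lra.
  by apply: hd' => //; rewrite ler0_norm; lra.
Qed.

Lemma continuous_itv_bounded (R : realType) (V : normedModType R) (g : R -> V)
    (a b : R) : continuous g -> exists2 M, 0 < M &
  forall t, a <= t <= b -> `|g t| <= M.
Proof.
move=> cg; have [ab|ba] := leP a b; last by exists 1 => // t; lra.
have [|c _ hc] := @EVT_max R (fun t => `|g t|) a b ab.
  by apply: continuous_subspaceT; exact: continuous_normr.
exists (`|g c| + 1) => [|t tab]; first by have := normr_ge0 (g c); lra.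
have := hc t; rewrite in_itv/= => /(_ tab); lra.
Qed.

(** * Bounds on histories and comparison of norms *)

Section neutral.
Variables (R : realType) (n p : nat) (Delta : R).
Hypothesis Delta_gt0 : 0 < Delta.
Local Notation H := (hist n Delta).
Implicit Types (x y : R -> 'cV[R]_n) (phi psi : H) (F G : H -> 'cV[R]_n).

(** Stands in for [supnorm] in all estimates: it uses the library norm and needs no supremum to
    exist. Going back and forth costs a factor [sqrt n]. *)
Definition bnd (g : R -> 'cV[R]_n) (c : R) :=
  forall s, - Delta <= s <= 0 -> `|g s| <= c.

Lemma bnd_ge0 g c : bnd g c -> 0 <= c.
Proof.
have D0 := Delta_gt0.
by move=> h; have := h 0 ltac:(lra); have := normr_ge0 (g 0); lra.
Qed.

Lemma bnd_le g c c' : c <= c' -> bnd g c -> bnd g c'.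
Proof. by move=> cc' h s hs; apply: le_trans (h s hs) cc'. Qed.

Lemma bnd_subC g g' c : bnd (g \- g') c -> bnd (g' \- g) c.
Proof. by move=> h s hs /=; rewrite distrC; exact: h. Qed.

Lemma hist_bnd phi : exists2 c, 0 < c & bnd phi c.
Proof.
have [M M0 hM] := continuous_itv_bounded (- Delta) 0 (hist_clamp_continuous (phi
  := phi) Delta_gt0).
exists M => // s hs; have := hM s hs.
by rewrite min_l ?max_r//; lra.
Qed.

Lemma enorm_ge_norm (v : 'cV[R]_n) : `|v| <= enorm v.
Proof.
rewrite -[leLHS]/(mx_norm v) mx_normrE.
apply: bigmax_le => [|[i j] _ /=]; first exact: sqrtr_ge0.
rewrite ord1 -sqrtr_sqr; apply: ler_wsqrtr.
by rewrite (bigD1 i)//= lerDl sumr_ge0// => k _; exact: sqr_ge0.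
Qed.

Lemma coord_le_norm (v : 'cV[R]_n) i : `|v i 0| <= `|v|.
Proof. by rewrite -[leRHS]/(mx_norm v) mx_normrE (le_bigmax _ _ (i, 0)). Qed.

Lemma norm_le_coord (v : 'cV[R]_n) c : 0 <= c -> (forall i, `|v i 0| <= c) ->
  `|v| <= c.
Proof.
move=> c0 h; rewrite -[leLHS]/(mx_norm v) mx_normrE.
by apply: bigmax_le => // -[i j] _; rewrite ord1.
Qed.

Lemma enorm_le_norm (v : 'cV[R]_n) : enorm v <= Num.sqrt n%:R * `|v|.
Proof.
rewrite -[X in _ * X](ger0_norm (normr_ge0 v)) -sqrtr_sqr -sqrtrM ?ler0n//.
apply: ler_wsqrtr; rewrite mulr_natl.
have -> : `|v| ^+ 2 *+ n = \sum_(i < n) `|v| ^+ 2 by rewrite sumr_const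
  card_ord.
apply: ler_sum => i _.
rewrite -[v i 0 ^+ 2]ger0_norm ?sqr_ge0// normrX.
by rewrite ler_pXn2r ?nnegrE// coord_le_norm.
Qed.

Lemma continuous_enorm (g : R -> 'cV[R]_n) (a b : R) :
  continuous g -> exists2 M, 0 < M & forall t, a <= t <= b -> enorm (g t) <= M.
Proof.
move=> cg; have [M M0 hM] := continuous_itv_bounded a b cg.
exists (Num.sqrt n%:R * M + 1).
  by have := mulr_ge0 (sqrtr_ge0 (n%:R : R)) (ltW M0); lra.
move=> t ht; have := enorm_le_norm (g t).
by have := ler_wpM2l (sqrtr_ge0 (n%:R : R)) (hM t ht); lra.
Qed.

Lemma supnorm_le_bnd (d : R) (g : R -> 'cV[R]_n) c : 0 <= d ->
  (forall s, - d <= s <= 0 -> `|g s| <= c) -> supnorm d g <= Num.sqrt n%:R * c.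
Proof.
move=> d0 h; apply: ge_sup.
  by exists (enorm (g 0)); exists 0 => //=; rewrite in_itv/=; lra.
move=> _ [s /= + <-]; rewrite in_itv/= => hs.
by apply: le_trans (enorm_le_norm _) _; rewrite ler_wpM2l ?sqrtr_ge0// h.
Qed.

Lemma bnd_supnorm phi psi : bnd (phi \- psi) (supnorm Delta (phi \- psi)).
Proof.
have cphi := hist_clamp_continuous (phi := phi) Delta_gt0.
have cpsi := hist_clamp_continuous (phi := psi) Delta_gt0.
have [M M0 hM] := @continuous_enorm _ (- Delta) 0
  (fun t => cvgB (cphi t) (cpsi t)).
move=> s hs; apply: le_trans (enorm_ge_norm _) _; apply: ub_le_sup.
  exists M => _ [u /= + <-]; rewrite in_itv/= => hu.
  have := hM u hu.
  by rewrite !fctE min_l ?max_r//; lra.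
by exists s => //=; rewrite in_itv.
Qed.

End neutral.

(** * Solutions through right derivatives *)

Lemma continuous_sum_mulmx (R : realType) (n p : nat) (A : 'I_p -> 'M[R]_n)
    (g : 'I_p -> R -> 'cV[R]_n) : (forall j, continuous (g j)) ->
  continuous (fun t => \sum_(j < p) A j *m g j t).
Proof.
move=> cg; apply: (@continuous_big 'cV[R]_n _ +%R 0 xpredT) => [|j _ t].
  exact: add_continuous.
exact: (@continuous_comp _ _ _ (g j) _ t (cg j t) (@mulmxl_continuous _ _ _ _)).
Qed.

Lemma continuous_translate (R : realType) (V : normedModType R) (x : R -> V) c :
  continuous x -> continuous (fun t => x (t + c)).
Proof.
move=> cx t; apply: (@continuous_comp _ _ _ (fun u => u + c) x t);
  last exact: cx.
by apply: cvgD; [exact: cvg_id|exact: cvg_cst].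
Qed.

Lemma continuous_sub (R : realType) (V : normedModType R) (x y : R -> V) :
  continuous x -> continuous y -> continuous (x \- y).
Proof. by move=> cx cy t; apply: cvgB; [exact: cx|exact: cy]. Qed.

Lemma sum_mulmx_bound (R : realType) (n p : nat) (A : 'I_p -> 'M[R]_n) :
  exists2 a : R, 0 <= a & forall (v : 'I_p -> 'cV[R]_n) c,
    (forall j, `|v j| <= c) -> 0 <= c -> `|\sum_(j < p) A j *m v j| <= a * c.
Proof.
exists (\sum_(j < p) \sum_(i < n) \sum_(k < n) `|A j i k|).
  by apply: sumr_ge0 => j _; apply: sumr_ge0 => i _; exact: sumr_ge0.
move=> v c hv c0; rewrite mulr_suml (le_trans (ler_norm_sum _ _ _))//.
apply: ler_sum => j _; apply: norm_le_coord.
  by rewrite mulr_ge0// sumr_ge0// => i _; exact: sumr_ge0.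
move=> i; rewrite mxE (le_trans (ler_norm_sum _ _ _))//.
rewrite [X in _ <= X * _](bigD1 i)//= mulrDl -[leLHS]addr0 lerD//; last first.
  by rewrite mulr_ge0// sumr_ge0// => i' _; exact: sumr_ge0.
rewrite mulr_suml; apply: ler_sum => k _; rewrite normrM ler_wpM2l//.
exact: le_trans (coord_le_norm _ _) (hv j).
Qed.

(** On a time step of length [r] all delayed terms are data already known: the method of steps.
    Starting the minimum at [Delta] gives [r <= Delta]. *)
Lemma min_delay (R : realType) (p : nat) (Delta : R) (delay : 'I_p -> R) :
  0 < Delta -> (forall j, 0 < delay j <= Delta) ->
  exists r : R, [/\ 0 < r, r <= Delta & forall j, r <= delay j].
Proof.
move=> D0 hd; exists (\big[Num.min/Delta]_(j < p) delay j); split.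
- by apply: lt_bigmin => // j _; have /andP[] := hd j.
- exact: bigmin_le_id.
- by move=> j; exact: bigmin_le.
Qed.

Definition rderiv (R : realType) (V : normedModType R) (g g' : R -> V) (b : R)
  :=
  forall t, 0 <= t < b -> forall e, 0 < e -> exists2 d, 0 < d &
  forall h, 0 < h < d -> `|g (t + h) - g t - h *: g' t| <= e * h.

(** Mean value inequality, for a difference so that it serves both to compare two solutions and,
    with [k] affine, to compare one with its tangent. *)
Lemma rderiv_diff_le (R : realType) (V : normedModType R)
    (g g' k k' : R -> V) (b s t c : R) : continuous g -> continuous k ->
  rderiv g g' b -> rderiv k k' b -> 0 <= s -> s <= t -> t <= b ->
  (forall u, s <= u < t -> `|g' u - k' u| <= c) ->
  `|(g t - k t) - (g s - k s)| <= c * (t - s).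
Proof.
move=> cg ck dg dk s0 st tb hc.
apply: (@dini_norm_le _ _ (g \- k) s t c (continuous_sub cg ck) st).
move=> u hu e e0.
have [d d0 hd] := dg u ltac:(lra) (e / 2) ltac:(lra).
have [d' d'0 hd'] := dk u ltac:(lra) (e / 2) ltac:(lra).
exists (Num.min d d'); first by rewrite lt_min d0.
move=> h /andP[h0]; rewrite lt_min => /andP[hd1 hd2].
have h1 := hd h ltac:(lra); have h2 := hd' h ltac:(lra).
have -> : (g \- k) (u + h) - (g \- k) u = (g (u + h) - g u - h *: g' u)
    - (k (u + h) - k u - h *: k' u) + h *: (g' u - k' u).
  rewrite /= scalerBr !opprD !opprK !addrA.
  set a1 := g _; set a2 := k _; set a3 := g u; set a4 := k u.
  set b1 := _ *: _; set b2 := _ *: _.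
  by rewrite [RHS](AC (8) (1*4*2*5*(3*7)*(6*8)))//= addNr subrr !addr0.
apply: le_trans (ler_normD _ _) _; rewrite normrZ (gtr0_norm h0).
have := ler_normB (g (u + h) - g u - h *: g' u) (k (u + h) - k u - h *: k' u).
have := ler_wpM2l (ltW h0) (hc u hu); lra.
Qed.

(* Sealed: comparing two segments by unfolding [restr] is very slow. *)
HB.lock Definition seg (R : realType) (n : nat) (Delta : R)
  (x : R -> 'cV[R]_n) (t : R) : hist n Delta :=
  segment Delta x t.

Section neutral.
Variables (R : realType) (n p : nat) (Delta : R).
Variables (A : 'I_p -> 'M[R]_n) (delay : 'I_p -> R).
Hypothesis Delta_gt0 : 0 < Delta.
Hypothesis delayP : forall j, 0 < delay j <= Delta.
Local Notation H := (hist n Delta).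
Implicit Types (x y : R -> 'cV[R]_n) (phi psi : H) (F G : H -> 'cV[R]_n).
Local Notation sg := (seg Delta).

Lemma sgE x t s : continuous x -> - Delta <= s <= 0 -> sg x t s = x (t + s).
Proof.
move=> cx hs; rewrite seg.unlock restrE; [by []| |by rewrite /= in_itv].
apply: continuous_subspaceT.
have -> : (fun tau => x (t + tau)) = (fun tau => x (tau + t)).
  by apply/funext => u; rewrite addrC.
exact: continuous_translate cx.
Qed.

(** [D x_t] read on [x] itself, without building a segment; see [neutral_op_sg]. *)
Definition neutral_diff x (t : R) : 'cV[R]_n :=
  x t - \sum_(j < p) A j *m x (t - delay j).
Local Notation nD := neutral_diff.

Lemma nD_continuous x : continuous x -> continuous (nD x).
Proof.
move=> cx; apply: (continuous_sub cx); apply: continuous_sum_mulmx => j.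
exact: continuous_translate cx.
Qed.

Lemma nDB x y t : nD (x \- y) t = nD x t - nD y t.
Proof.
rewrite /nD /=; under eq_bigr do rewrite mulmxBr.
by rewrite sumrB !opprB; set X := \sum_(i < p) _; set Y := \sum_(i < p) _;
  apply/matrixP => i j; rewrite !mxE; lra.
Qed.

Lemma neutral_op_sg x t : continuous x -> neutral_op A delay (sg x t) = nD x t.
Proof.
have D0 := Delta_gt0; move=> cx.
have h0 : - Delta <= (0 : R) <= 0 by lra.
rewrite /neutral_op /nD (sgE _ cx h0) addr0; congr (_ - _).
apply: eq_bigr => j _.
have hj : - Delta <= - delay j <= 0 by have := delayP j; lra.
by rewrite (sgE _ cx hj).
Qed.

(* Only the right derivative is prescribed: for continuous [x] and [F] Lipschitz
   on bounded sets this is equivalent to the equation in [global_solution], see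
   [global_solution_of_rsol] and [rsol_of_global_solution]. *)
Definition right_solution F x b := rderiv (nD x) (fun t => F (sg x t)) b.
Local Notation rsol := right_solution.

Lemma bnd_sg x t c : continuous x ->
  (forall u, t - Delta <= u <= t -> `|x u| <= c) -> bnd Delta (sg x t) c.
Proof. by move=> cx h s hs; rewrite (sgE _ cx hs); apply: h; lra. Qed.

Lemma bnd_sgB x y t c : continuous x -> continuous y ->
  (forall u, t - Delta <= u <= t -> `|x u - y u| <= c) ->
  bnd Delta (sg x t \- sg y t) c.
Proof. move=> cx cy h s hs; rewrite /= (sgE _ cx hs) (sgE _ cy hs).
by apply: h; lra. Qed.

Lemma sg_continuous x t e : continuous x -> 0 < e -> exists2 d, 0 < d &
  forall u, `|u - t| < d -> bnd Delta (sg x u \- sg x t) e.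
Proof.
move=> cx e0.
have [d d0 hd] := unif_continuous_itv (t - Delta) t cx e0.
exists d => //.
move=> u ut s hs.
rewrite /=.
rewrite (sgE u cx hs).
rewrite (sgE t cx hs).
apply: hd; first lra.
have -> : u + s - (t + s) = u - t by lra.
by [].
Qed.

Lemma sg_shift x c t : continuous x -> sg (fun u => x (u + c)) t = sg x (t + c).
Proof.
move=> cx; apply: hist_ext => s; rewrite /= in_itv/= => hs.
rewrite (sgE _ (continuous_translate cx) hs).
rewrite (sgE _ cx hs).
rewrite addrAC. by [].
Qed.

Lemma nD_shift x c t : nD (fun u => x (u + c)) t = nD x (t + c).
Proof. by rewrite /nD; congr (_ - _); apply: eq_bigr => j _;
  rewrite addrAC. Qed.

Lemma rsol_shift F x b c : continuous x -> 0 <= c -> rsol F x (b + c) ->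
  rsol F (fun u => x (u + c)) b.
Proof.
move=> cx c0 sx t ht e e0; have [d d0 hd] := sx (t + c) ltac:(lra) e e0.
exists d => // h hh; rewrite !nD_shift (sg_shift _ _ cx) (addrAC t h c).
exact: hd.
Qed.

Lemma rsol_diff_le F G x y b s t c : continuous x -> continuous y ->
  rsol F x b -> rsol G y b -> 0 <= s -> s <= t -> t <= b ->
  (forall u, s <= u < t -> `|F (sg x u) - G (sg y u)| <= c) ->
  `|nD (x \- y) t - nD (x \- y) s| <= c * (t - s).
Proof.
move=> cx cy sx sy s0 st tb h; rewrite !nDB.
exact: (rderiv_diff_le (nD_continuous cx) (nD_continuous cy) sx sy).
Qed.

(** With [w = 0] it bounds the variation of [D x_t]; with [w] the value of [F] at an endpoint it
    yields a derivative from either side. *)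
Lemma rsol_affine_le F x b s t w c : continuous x -> rsol F x b ->
  0 <= s -> s <= t -> t <= b ->
  (forall u, s <= u < t -> `|F (sg x u) - w| <= c) ->
  `|nD x t - nD x s - (t - s) *: w| <= c * (t - s).
Proof.
move=> cx sx s0 st tb h.
have -> : nD x t - nD x s - (t - s) *: w = (nD x t - t *: w) - (nD x s - s *:
  w).
  by apply/matrixP => i j; rewrite !mxE; lra.
have cw : continuous (fun u : R => u *: w).
  by move=> u; apply: cvgZr_tmp; exact: cvg_id.
apply: (rderiv_diff_le (k' := fun=> w) (nD_continuous cx) cw sx _ s0 st tb h).
move=> u hu e e0; exists 1 => // k hk.
have -> : (u + k) *: w - u *: w - k *: w = 0.
  by apply/matrixP => i j; rewrite !mxE; lra.
by rewrite normr0 mulr_ge0//; lra.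
Qed.

Definition lip_bounded F := forall B, exists2 L, 0 < L & forall phi psi c,
  bnd Delta phi B -> bnd Delta psi B -> bnd Delta (phi \- psi) c ->
  `|F phi - F psi| <= L * c.

Lemma lip_bounded_of_enorm F : lipschitz_on_bounded_sets F -> lip_bounded F.
Proof.
have D0 := Delta_gt0.
move=> hF B; set N := Num.sqrt (n%:R : R).
have N0 : 0 <= N by exact: sqrtr_ge0.
have NB0 : 0 <= N * `|B| by exact: mulr_ge0.
have [L L0 hL] := hF (N * `|B| + 1) ltac:(lra).
have LN : 0 <= L * N by apply: mulr_ge0 => //; exact: ltW.
exists (L * N + 1); first lra.
move=> phi psi c h1 h2 h12; have c0 := bnd_ge0 Delta_gt0 h12.
have hB (g : R -> 'cV[R]_n) : bnd Delta g B -> supnorm Delta g <= N * `|B| + 1.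
  move=> hg; apply: le_trans (supnorm_le_bnd (ltW D0) hg) _.
  by rewrite -/N; have := ler_wpM2l N0 (ler_norm B); lra.
apply: le_trans (enorm_ge_norm _) _.
apply: le_trans (hL _ _ (hB _ h1) (hB _ h2)) _.
have h3 : supnorm Delta (phi \- psi) <= N * c := supnorm_le_bnd (ltW D0) h12.
by have := ler_wpM2l (ltW L0) h3; lra.
Qed.

End neutral.

Lemma ler_norm_chain (R : realType) (V : normedModType R) (u v w z : V)
    (a b c d : R) : `|u - v| <= a -> `|v - w| <= b -> `|z - w| <= c ->
  `|z| <= d -> `|u| <= a + b + c + d.
Proof.
move=> h1 h2 h3 h4; have := ler_distD v u 0; have := ler_distD w v 0.
by have := ler_distD z w 0; rewrite !subr0 (distrC w z); lra.
Qed.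

(** * Continuous dependence and uniqueness *)

Section neutral.
Variables (R : realType) (n p : nat) (Delta : R).
Variables (A : 'I_p -> 'M[R]_n) (delay : 'I_p -> R).
Hypothesis Delta_gt0 : 0 < Delta.
Hypothesis delayP : forall j, 0 < delay j <= Delta.
Local Notation H := (hist n Delta).
Implicit Types (x y : R -> 'cV[R]_n) (phi psi : H) (F G : H -> 'cV[R]_n).
Local Notation sg := (seg Delta).
Local Notation nD := (neutral_diff A delay).
Local Notation rsol := (right_solution A delay).
Local Tactic Notation "lra_from" ne_hyp_list(hs) :=
  (clear - A Delta_gt0 delayP hs); lra.

(** The difference is the delayed sum, and for [t] within [r] of [t0] its arguments lie in the
    window that ends at [t0]. *)
Lemma nD_step a r x t0 t c : (forall (v : 'I_p -> 'cV[R]_n) c,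
    (forall j, `|v j| <= c) -> 0 <= c -> `|\sum_(j < p) A j *m v j| <= a * c) ->
  (forall j, r <= delay j) -> 0 <= r -> t0 <= t <= t0 + r -> 0 <= c ->
  (forall u, t0 - Delta <= u <= t0 -> `|x u| <= c) ->
  `|x t - nD x t| <= a * c.
Proof.
move=> aP rP r0 ht c0 hx; rewrite /nD opprB addrC subrK.
by apply: aP => // j; apply: hx; have := rP j; have := delayP j; lra.
Qed.

(** Let [E] be the largest distance on the step, attained at [s]. Going from [x s - y s] to its
    [nD], to [nD] at [t0], and back to the function costs [a * c], then [(E + c) / 2] because
    [L * tau <= 1/2], then [a * c] and [c]. Absorbing [E / 2] on the left gives the factor
    [3 + 4 * a]. *)
Lemma lipschitz_dependence_step F a r L B x y b t0 tau c :
  (forall (v : 'I_p -> 'cV[R]_n) c,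
    (forall j, `|v j| <= c) -> 0 <= c -> `|\sum_(j < p) A j *m v j| <= a * c) ->
  (forall j, r <= delay j) -> 0 <= a -> 0 <= r -> 0 < L ->
  (forall phi psi c, bnd Delta phi B -> bnd Delta psi B ->
    bnd Delta (phi \- psi) c -> `|F phi - F psi| <= L * c) ->
  continuous x -> continuous y -> rsol F x b -> rsol F y b ->
  (forall u, - Delta <= u <= b -> `|x u| <= B) ->
  (forall u, - Delta <= u <= b -> `|y u| <= B) ->
  0 <= t0 -> 0 <= tau <= r -> L * tau <= 2^-1 -> t0 + tau <= b -> 0 <= c ->
  (forall u, t0 - Delta <= u <= t0 -> `|x u - y u| <= c) ->
  forall t, t0 <= t <= t0 + tau -> `|x t - y t| <= (3 + 4 * a) * c.
Proof.
have D0 := Delta_gt0.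
move=> aP rP a0 r0 L0 hF cx cy sx sy bx by_ t00 tau0 Ltau t0b c0 hc t ht.
have cxy := continuous_sub cx cy.
have [E [E0 hE [s hs Es]]] : exists E, [/\ 0 <= E,
    forall u, t0 <= u <= t0 + tau -> `|x u - y u| <= E &
    exists2 s, t0 <= s <= t0 + tau & E = `|x s - y s|].
  have [||s hs hmax] := @EVT_max R (fun t => `|(x \- y) t|) t0 (t0 + tau).
  - by lra_from tau0.
  - by apply: continuous_subspaceT; exact: continuous_normr.
  exists `|(x \- y) s|; split=> [|u hu|]; first by [].
  - by apply: hmax; rewrite in_itv.
  - by exists s => //; move: hs; rewrite in_itv.
suff : E <= (3 + 4 * a) * c by apply: le_trans; exact: hE.
have hc' u : t0 - Delta <= u <= t0 -> `|(x \- y) u| <= c by exact: hc.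
have h1 : `|(x \- y) s - nD (x \- y) s| <= a * c.
  by apply: (nD_step aP rP r0 _ c0 hc'); lra_from hs tau0.
have h2 : `|(x \- y) t0 - nD (x \- y) t0| <= a * c.
  by apply: (nD_step aP rP r0 _ c0 hc'); lra_from tau0.
have h3 : `|nD (x \- y) s - nD (x \- y) t0| <= L * (E + c) * (s - t0).
  have [st0 sb] : t0 <= s /\ s <= b by lra_from hs t0b.
  apply: (rsol_diff_le cx cy sx sy t00 st0 sb) => u hu.
  apply: hF; [apply: (bnd_sg cx)|apply: (bnd_sg cy)|apply: (bnd_sgB cx cy)] => v
    hv.
  - by apply: bx; lra_from hv hu sb t00.
  - by apply: by_; lra_from hv hu sb t00.
  - have [vt|tv] := leP v t0.
      by apply: le_trans (hc v _) _; lra_from hv hu sb t00 vt E0.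
    by apply: le_trans (hE v _) _; lra_from hv hu hs t00 tv c0.
have h4 : L * (E + c) * (s - t0) <= (E + c) / 2.
  rewrite mulrAC [leRHS]mulrC ler_wpM2r ?addr_ge0//.
  by apply: le_trans Ltau; rewrite ler_pM2l// lerBlDl; case/andP: hs.
have h5 : `|(x \- y) t0| <= c by apply: hc; lra_from D0.
have := ler_norm_chain h1 h3 h2 h5; rewrite /= -Es; lra_from h4.
Qed.

(** The factor of one step is raised to the number of steps that cover [[0, T]], so [C] depends on
    [B] and [T] but not on the two solutions; [weighted_excess_lip] needs this uniformity. *)
Lemma lipschitz_dependence F B T : lip_bounded F -> exists2 C, 0 < C &
  forall x y c, continuous x -> continuous y -> rsol F x T -> rsol F y T ->
  (forall u, - Delta <= u <= T -> `|x u| <= B) ->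
  (forall u, - Delta <= u <= T -> `|y u| <= B) ->
  (forall u, - Delta <= u <= 0 -> `|x u - y u| <= c) ->
  forall t, - Delta <= t <= T -> `|x t - y t| <= C * c.
Proof.
have D0 := Delta_gt0.
move=> /(_ B)[L L0 hF]; have [a a0 aP] := sum_mulmx_bound A.
have [r [r0 rD rP]] := min_delay D0 delayP.
pose tau := Num.min r (2^-1 / L).
have tau0 : 0 < tau by rewrite lt_min r0 divr_gt0.
have taur : tau <= r by rewrite ge_min lexx.
have Ltau : L * tau <= 2^-1.
  by rewrite mulrC -ler_pdivlMr// ge_min lexx orbT.
have K1 : 1 <= 3 + 4 * a by lra.
have [m hm] : exists m : nat, T <= m%:R * tau.
  exists (Num.truncn (T / tau)).+1; rewrite -ler_pdivrMr//; apply: ltW.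
  exact: truncnS_gt.
exists ((3 + 4 * a) ^+ m); first by apply: exprn_gt0; lra.
move=> x y c cx cy sx sy bx by_ hc t ht.
have c0 : 0 <= c by apply: le_trans (hc 0 _) => //; lra_from D0.
suff H k u : - Delta <= u <= T -> u <= k%:R * tau ->
    `|x u - y u| <= (3 + 4 * a) ^+ k * c by apply: H => //; lra_from hm ht.
elim: k u => [|k IH] u hu uk; first by rewrite expr0 mul1r; apply: hc;
  lra_from hu uk.
have [uk'|ku] := leP u (k%:R * tau).
  apply: le_trans (IH u hu uk') _; rewrite exprS -mulrA ler_peMl//.
  by rewrite mulr_ge0// exprn_ge0//; lra.
rewrite exprS -mulrA.
have kt0 : 0 <= k%:R * tau by rewrite mulr_ge0// ltW.
have uk2 : u <= k%:R * tau + tau by move: uk; rewrite -natr1 mulrDl mul1r.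
apply: (lipschitz_dependence_step (b := T) (t0 := k%:R * tau)
  (tau := u - k%:R * tau) aP rP a0 (ltW r0) L0 hF cx cy sx sy bx by_ kt0).
- by lra_from uk2 taur ku.
- by apply: le_trans Ltau; rewrite ler_pM2l// lerBlDl.
- by lra_from hu.
- by rewrite mulr_ge0// exprn_ge0//; lra_from a0.
- by move=> v hv; apply: IH; lra_from hv ku hu kt0.
- by lra_from ku.
Qed.

Lemma rsol_unique F x y : lip_bounded F -> continuous x -> continuous y ->
  (forall b, rsol F x b) -> (forall b, rsol F y b) ->
  (forall u, - Delta <= u <= 0 -> x u = y u) ->
  forall t, - Delta <= t -> x t = y t.
Proof.
move=> hF cx cy sx sy hxy t ht.
have [B1 _ hB1] := continuous_itv_bounded (- Delta) t cx.
have [B2 _ hB2] := continuous_itv_bounded (- Delta) t cy.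
have [C _ hC] := lipschitz_dependence (Num.max B1 B2) t hF.
apply/eqP; rewrite -subr_eq0 -normr_le0 -(mulr0 C).
apply: hC => // [u hu|u hu|u hu|].
- by rewrite le_max hB1.
- by rewrite le_max hB2 ?orbT.
- by rewrite hxy// subrr normr0.
- by rewrite ht lexx.
Qed.

End neutral.

(** * Primitives and Picard iteration *)

Lemma geometric_cauchy_real (R : realType) (u : nat -> R) (c : R) :
  (forall k, `|u k.+1 - u k| <= c / 2 ^+ k) ->
  exists l, forall k, `|u k - l| <= 2 * c / 2 ^+ k.
Proof.
move=> hu; have p0 k : 0 < (2 : R) ^+ k by rewrite exprn_gt0.
pose q k := c / 2 ^+ k; have qS k : q k = 2 * q k.+1.
  by rewrite /q exprS; have := lt0r_neq0 (p0 k) => h; field.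
have q0 k : 0 <= q k by exact: le_trans (normr_ge0 _) (hu k).
pose v k := u k - 2 * q k; pose w k := u k + 2 * q k.
have hv k : v k <= v k.+1.
  have := hu k; rewrite -/(q k) ler_norml /v => /andP[h _].
  by have := qS k; lra.
have hw k : w k.+1 <= w k.
  have := hu k; rewrite -/(q k) ler_norml /w => /andP[_ h].
  by have := qS k; lra.
have vmono i j : v i <= v (i + j)%N.
  by elim: j => [|j IH]; [rewrite addn0|rewrite addnS (le_trans IH)].
have wmono i j : w (i + j)%N <= w i.
  by elim: j => [|j IH]; [rewrite addn0|rewrite addnS (le_trans _ IH)].
have vw i j : v i <= w j.
  apply: le_trans (vmono i j) (le_trans _ (wmono j i)); rewrite addnC /v /w.
  by have := q0 (j + i)%N; lra.
have S0 : has_sup (range v).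
  by split; [exists (v 0%N), 0%N|exists (w 0%N) => _ [i _ <-]].
exists (sup (range v)) => k; rewrite -mulrA -/(q k).
have h1 : v k <= sup (range v) by apply: ub_le_sup; [case: S0|exists k].
have h2 : sup (range v) <= w k by apply: ge_sup; [case: S0|move=> _ [i _ <-]].
by rewrite ler_norml; move: h1 h2; rewrite /v /w; lra.
Qed.

Lemma geometric_cauchy_vector (R : realType) (n : nat) (u : nat -> 'cV[R]_n)
    (c : R) : (forall k, `|u k.+1 - u k| <= c / 2 ^+ k) ->
  exists l, forall k, `|u k - l| <= 2 * c / 2 ^+ k.
Proof.
move=> hu.
have /choice[l hl] : forall i : 'I_n, exists l, forall k,
    `|u k i 0 - l| <= 2 * c / 2 ^+ k.
  move=> i; apply: geometric_cauchy_real => k.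
  by apply: le_trans (hu k); have := coord_le_norm (u k.+1 - u k) i;
    rewrite !mxE.
exists (\col_i l i) => k; apply: norm_le_coord => [|i]; last by rewrite !mxE.
rewrite -mulrA mulr_ge0//; exact: le_trans (normr_ge0 _) (hu k).
Qed.

(** The integral starts at [-1] so that [0] is an interior point for the fundamental theorem, and
    its argument is cut at [0] so that [G] is continuous on the whole line. *)
Lemma primitive_real (R : realType) (g : R -> R) : continuous g ->
  exists G : R -> R, [/\ continuous G, G 0 = 0 & forall b, rderiv G g b].
Proof.
move=> cg; pose mu := @lebesgue_measure R.
pose I (x : R) : R := (\int[mu]_(t in [set` `[-1, x]]) g t)%R.
have dI (x : R) : 0 <= x -> derivable I x 1 /\ derive1 I x = g x.
  move=> x0; apply: (@continuous_FTC1_closed _ _ _ _ (x + 1)).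
  - lra.
  - apply: continuous_compact_integrable; first exact: segment_compact.
    exact: continuous_subspaceT.
  - lra.
  - exact: cg.
have cI' : continuous (fun t : R => I (Num.max 0 t)).
  move=> t.
  have [/derivable1_diffP dx _] := dI (Num.max 0 t) ltac:(by rewrite le_max
    lexx).
  apply: (@continuous_comp _ _ _ (fun u : R => Num.max 0 u) I t _
    (differentiable_continuous dx)).
  by apply: (@continuous_max R R (fun=> 0) id t);
    [exact: cvg_cst|exact: cvg_id].
exists (fun t : R => I (Num.max 0 t) - I 0); split.
- by move=> t; apply: cvgB; [exact: cI'|exact: cvg_cst].
- by rewrite max_l// subrr.
- move=> b t /andP[t0 _] e e0; have [dt gt] := dI t t0.
  move: gt; rewrite derive1E => gt.
  have /cvgrPdist_le/(_ e e0) := dt.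
  rewrite -[lim _]/('D_1 I t) gt => /nbhs_ballP[d /= d0 hd].
  exists d => // h /andP[h0 hd']; have := hd h;
    rewrite /ball/= sub0r normrN gtr0_norm//.
  move=> /(_ hd' (lt0r_neq0 h0)); rewrite /= distrC.
  rewrite !max_r//; last by rewrite addr_ge0// ltW.
  have -> : h *: (1 : R) + t = t + h by rewrite addrC -[_ *: _]/(h * 1) mulr1.
  move=> hh.
  have -> : I (t + h) - I 0 - (I t - I 0) - h *: g t =
     h * (h^-1 *: (I (t + h) - I t) - g t).
    rewrite mulrBr -[h^-1 *: _]/(h^-1 * _) mulrA divff ?lt0r_neq0// mul1r.
    by rewrite -[h *: _]/(h * g t); lra.
  by rewrite normrM gtr0_norm// mulrC ler_wpM2r// ltW.
Qed.

Lemma primitive_vector (R : realType) (n : nat) (g : R -> 'cV[R]_n) :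
  continuous g -> exists G : R -> 'cV[R]_n,
    [/\ continuous G, G 0 = 0 & forall b, rderiv G g b].
Proof.
move=> cg.
have cgi (i : 'I_n) : continuous (fun t => g t i 0).
  move=> t; apply: (@continuous_comp _ _ _ g (fun v : 'cV[R]_n => v i 0) t (cg
    t)).
  exact: coord_continuous.
have /choice[G hG] : forall i : 'I_n, exists G : R -> R,
    [/\ continuous G, G 0 = 0 & forall b, rderiv G (fun t => g t i 0) b].
  by move=> i; exact: primitive_real (cgi i).
(* The error is controlled by the oscillation of [g], hence by the same bound in all coordinates. *)
have key s t c : 0 <= s <= t -> (forall u, s <= u < t -> `|g u - g s| <= c) ->
    0 <= c -> `|\col_i G i t - \col_i G i s - (t - s) *: g s| <= c * (t - s).
  move=> /andP[s0 st] hc c0; apply: norm_le_coord => [|i].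
    by rewrite mulr_ge0// subr_ge0.
  rewrite !mxE; have [cGi _ dGi] := hG i.
  have -> : G i t - G i s - (t - s) * g s i 0 =
    (G i t - t * g s i 0) - (G i s - s * g s i 0) by lra.
  have ck : continuous (fun u : R => u * g s i 0).
    by move=> u; apply: cvgM; [exact: cvg_id|exact: cvg_cst].
  have dk : rderiv (fun u : R => u * g s i 0) (fun=> g s i 0) t.
    move=> u hu e e0; exists 1 => // h /andP[h0 _].
    rewrite -[h *: _]/(h * _) (_ : _ - _ = 0) ?normr0 ?mulr_ge0// ?ltW//; lra.
  apply: (rderiv_diff_le cGi ck (dGi t) dk s0 st (lexx t)) => u hu.
  apply: le_trans (hc u hu).
  by have := coord_le_norm (g u - g s) i; rewrite !mxE.
have rG b : rderiv (fun t => \col_i G i t) g b.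
  move=> t ht e e0; have [d d0 hd] := (continuous_epsdelta g).1 cg t e e0.
  exists d => // h /andP[h0 hhd]; have := key t (t + h) e.
  rewrite (_ : t + h - t = h); last by lra.
  apply; [lra| |exact: ltW] => u hu; apply/ltW/hd.
  by rewrite ger0_norm; lra.
exists (fun t => \col_i G i t); split => //.
- apply/continuous_epsdelta => t e e0.
  have /choice[d hd] : forall i : 'I_n, exists d, 0 < d /\
      forall u, `|u - t| < d -> `|G i u - G i t| < e / 2.
    move=> i; have [cGi _ _] := hG i.
    have [d d0 hd] := (continuous_epsdelta (G i)).1 cGi t (e / 2) ltac:(lra).
    by exists d.
  exists (\big[Num.min/1]_i d i).
    by apply: lt_bigmin => // i _; case: (hd i).
  move=> u hu; apply: (@le_lt_trans _ _ (e / 2)); last lra.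
  apply: norm_le_coord => [|i]; first lra.
  rewrite !mxE; apply/ltW; case: (hd i) => _; apply.
  exact: lt_le_trans hu (bigmin_le _ _ _).
- by apply/matrixP => i j; rewrite !mxE; case: (hG i).
Qed.

Lemma geometric_small (R : realType) (c e : R) : 0 < e ->
  exists k, c / 2 ^+ k <= e.
Proof.
move=> e0; have [c0|c0] := leP c 0.
  by exists 0%N; rewrite expr0 divr1; lra.
exists (Num.truncn (c / e)).+1.
have h : c / e < (2 : R) ^+ (Num.truncn (c / e)).+1.
  apply: lt_le_trans (truncnS_gt _) _; rewrite -natrX ler_nat.
  by apply/ltnW/ltn_expl.
by rewrite ler_pdivrMr ?exprn_gt0// mulrC -ler_pdivrMr// ltW.
Qed.

Lemma eq_of_geometric (R : realType) (V : normedModType R) (u v : V) (c : R) :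
  (forall k, `|u - v| <= c / 2 ^+ k) -> u = v.
Proof.
move=> h; apply/eqP; rewrite -subr_eq0 -normr_le0.
apply: (@le_of_forall_eps _ _ _ 1) => // e e0; have [k hk] := geometric_small c
  e0.
by rewrite add0r mulr1; exact: le_trans (h k) hk.
Qed.

(** Integration contracts the exponentially weighted norm: [C / 4 * expR (lam * t)] grows at rate at
    least [L * C * expR (lam * t)] when [4 * L <= lam], so [v] has nonpositive right Dini
    derivative. *)
Lemma exp_growth_le (R : realType) (V : normedModType R) (G1 G2 g1 g2 : R -> V)
    (lam L C t : R) : continuous G1 -> continuous G2 ->
  rderiv G1 g1 t -> rderiv G2 g2 t -> G1 0 = G2 0 -> 0 <= t -> 0 <= C ->
  4 * L <= lam ->
  (forall u, 0 <= u <= t -> `|g1 u - g2 u| <= L * (C * expR (lam * u))) ->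
  `|G1 t - G2 t| <= C / 4 * expR (lam * t).
Proof.
move=> c1 c2 d1 d2 G0 t0 C0 Ll hg.
pose v s := `|G1 s - G2 s| - C / 4 * expR (lam * s).
have ce : continuous (fun s : R => C / 4 * expR (lam * s)).
  move=> s; apply: cvgM; first exact: cvg_cst.
  apply: (@continuous_comp _ _ _ (fun u : R => lam * u) (@expR R) s).
    by apply: cvgM; [exact: cvg_cst|exact: cvg_id].
  exact: continuous_expR.
have cv : continuous v.
  apply: (@continuous_sub _ _ (fun s => `|G1 s - G2 s| : R^o)) => //.
  by apply: continuous_normr; exact: continuous_sub.
suff : v t <= v 0 + 0 * (t - 0).
  rewrite /v G0 subrr normr0 mulr0 expR0; lra.
apply: dini_le => // s hs e e0.
have [d d0 hd] := d1 s hs (e / 2) ltac:(lra).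
have [d' d'0 hd'] := d2 s hs (e / 2) ltac:(lra).
exists (Num.min d d'); first by rewrite lt_min d0.
move=> h /andP[h0]; rewrite lt_min => /andP[hd1 hd2].
have e1 := hd h ltac:(lra); have e2 := hd' h ltac:(lra).
have e3 : `|G1 (s + h) - G2 (s + h)| <= `|G1 s - G2 s| +
    (e / 2 * h + e / 2 * h + h * (L * (C * expR (lam * s)))).
  have -> : G1 (s + h) - G2 (s + h) = (G1 s - G2 s) +
      ((G1 (s + h) - G1 s - h *: g1 s) - (G2 (s + h) - G2 s - h *: g2 s)
      + h *: (g1 s - g2 s)).
    rewrite scalerBr; set a1 := G1 (_ + _); set a2 := G2 (_ + _).
    set b1 := G1 s; set b2 := G2 s; set x1 := _ *: _; set x2 := _ *: _.
    rewrite !opprD !opprK !addrA.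
    rewrite [RHS](AC 10 (3*6*(1*4)*(2*7)*(5*9)*(8*10)))/=.
    by rewrite !(subrr, addNr) !addr0.
  apply: le_trans (ler_normD _ _) _; rewrite lerD2l.
  apply: le_trans (ler_normD _ _) _; apply: lerD.
    by apply: le_trans (ler_normB _ _) _; exact: lerD.
  rewrite normrZ (gtr0_norm h0); apply: ler_wpM2l; first exact: ltW.
  by apply: hg; lra.
have e4 : expR (lam * s) + lam * h * expR (lam * s) <= expR (lam * (s + h)).
  rewrite mulrDr expRD -[X in X + _]mulr1 [X in _ + X]mulrC -mulrDr.
  by rewrite ler_wpM2l ?expR_ge0 ?expR_ge1Dx.
have e5 := expR_ge0 (lam * s).
rewrite /v; move: e3 e4 e5.
set E := expR (lam * s); set E' := expR _; set N := `|_|; set N' := `|_|.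
move=> e3 e4 e5; have e6 : h * (L * (C * E)) <= C / 4 * (lam * h * E).
  have := ler_wpM2r (_ : 0 <= C * E * h) Ll.
  by rewrite !mulr_ge0//; [move=> /(_ isT); lra|exact: ltW].
by have := ler_wpM2l (_ : 0 <= C / 4) e4; move=> /(_ ltac:(lra)); lra.
Qed.

(** * Global existence for a globally Lipschitz right-hand side *)

Section existence.
Variables (R : realType) (n p : nat) (Delta : R).
Variables (A : 'I_p -> 'M[R]_n) (delay : 'I_p -> R).
Hypothesis Delta_gt0 : 0 < Delta.
Hypothesis delayP : forall j, 0 < delay j <= Delta.
Variables (F : hist n Delta -> 'cV[R]_n) (L : R).
Hypothesis L_ge0 : 0 <= L.
Hypothesis F_lip : forall (phi psi : hist n Delta) c, bnd Delta (phi \- psi) c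
  ->
  `|F phi - F psi| <= L * c.
Variable phi : hist n Delta.
Implicit Types x y : R -> 'cV[R]_n.
Local Notation sg := (seg Delta).
Local Notation nD := (neutral_diff A delay).
Local Notation rsol := (right_solution A delay).

Let phic (t : R) : 'cV[R]_n := phi (Num.max (- Delta) (Num.min t 0)).

Let phic_continuous : continuous phic.
Proof. exact: hist_clamp_continuous. Qed.

Let phicE s : - Delta <= s <= 0 -> phic s = phi s.
Proof. by move=> hs; rewrite /phic min_l ?max_r//; lra. Qed.

Let admissible x := continuous x /\ forall t, t <= 0 -> x t = phic t.

(** A relation and not a map, since the primitive [G] is only known to exist. The equation is solved
    for the present value: both the delayed sum and the integrand come from the old iterate. *)
Let picard x y := exists G, [/\ continuous G, G 0 = 0,
  forall b, rderiv G (fun t => F (sg x t)) b &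
  forall t, 0 <= t -> y t =
    neutral_op A delay phi + \sum_(j < p) A j *m x (t - delay j) + G t].

Lemma continuous_F_seg x : continuous x -> continuous (fun t => F (sg x t)).
Proof.
move=> cx; apply/continuous_epsdelta => t e e0.
have L1 : 0 < L + 1 by apply: ltr_wpDl.
have [d d0 hd] := sg_continuous Delta t cx (divr_gt0 e0 L1).
exists d => // u ut; apply: le_lt_trans (F_lip (hd u ut)) _.
rewrite mulrCA gtr_pMr// ltr_pdivrMr// mul1r; lra.
Qed.

Let picard_ex x : admissible x -> exists y, admissible y /\ picard x y.
Proof.
have D0 := Delta_gt0; move=> [cx xphi].
have [G [cG G0 dG]] := primitive_vector (continuous_F_seg cx).
pose m (t : R) : R := Num.max t 0.
have cm : continuous m.
  by move=> t; apply: (@continuous_max R R id (fun=> 0) t);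
    [exact: cvg_id|exact: cvg_cst].
(* For [t <= 0] one has [m t = 0], so both corrections vanish and [phic] remains. For [t >= 0] the
   constant terms add up to [neutral_op A delay phi]. *)
pose y t := phic t + \sum_(j < p) A j *m (x (m t - delay j) - phi (- delay j)) +
  G (m t).
have hj j : phi (- delay j) = x (- delay j).
  by rewrite xphi ?phicE//; have := delayP j; lra.
exists y; split; first split.
- move=> t; apply: cvgD; last exact: (@continuous_comp _ _ _ m G t (cm t) (cG
    _)).
  apply: cvgD; first exact: phic_continuous.
  move: t; apply: continuous_sum_mulmx => j t; apply: cvgB; last exact: cvg_cst.
  apply: (@continuous_comp _ _ _ (fun u => m u - delay j) x t _ (cx _)).
  by apply: cvgB; [exact: cm|exact: cvg_cst].
- move=> t t0; rewrite /y (_ : m t = 0) ?G0; last by rewrite /m max_r.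
  by rewrite big1 ?addr0// => j _; rewrite sub0r hj subrr mulmx0.
- exists G; split => // t t0.
  rewrite /y (_ : m t = t); last by rewrite /m max_l.
  congr (_ + _); rewrite (_ : phic t = phi 0); last first.
    by rewrite /phic min_r// max_r//; lra.
  under eq_bigr do rewrite mulmxBr.
  by rewrite sumrB /neutral_op addrA addrAC.
Qed.

Local Tactic Notation "lra_from" ne_hyp_list(hs) :=
  (clear - A Delta_gt0 delayP L_ge0 F_lip phicE phic_continuous picard_ex hs);
    lra.

Lemma rsol_exists : exists x, [/\ continuous x,
  forall t, - Delta <= t <= 0 -> x t = phi t & forall b, rsol F x b].
Proof.
have D0 := Delta_gt0; have L0 := L_ge0.
have [a a0 aP] := sum_mulmx_bound A.
have [r [r0 rD rP]] := min_delay D0 delayP.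
(* The delayed sum looks back by at least [r] and gains [a * expR (- lam * r) <= 1/4]; the integral
   gains [1/4] because [4 * L <= lam]. Together the iteration contracts by [1/2]. The last summand
   gives [lam >= 1], used for [1 + t <= expR (lam * t)]. *)
pose lam := 4 * a / r + 4 * L + 1.
have ar0 : 0 <= 4 * a / r by rewrite !mulr_ge0// invr_ge0 ltW.
have lamL : 4 * L <= lam by rewrite /lam; lra_from ar0.
have lam1 : 1 <= lam by rewrite /lam; lra_from ar0 L0.
have lama : 4 * a <= expR (lam * r).
  apply: le_trans (expR_ge1Dx _).
  have : 4 * a <= lam * r.
    rewrite /lam !mulrDl divfK ?gt_eqF//.
    by have := mulr_ge0 L0 (ltW r0); lra.
  by lra.
have contract x1 x2 y1 y2 C : admissible x1 -> admissible x2 -> admissible y1 ->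
    admissible y2 -> picard x1 y1 -> picard x2 y2 -> 0 <= C ->
    (forall t, `|x1 t - x2 t| <= C * expR (lam * t)) ->
    forall t, `|y1 t - y2 t| <= C / 2 * expR (lam * t).
  move=> [cx1 _] [cx2 _] [cy1 ey1] [cy2 ey2] [G1 [cG1 G10 dG1 yG1]].
  move=> [G2 [cG2 G20 dG2 yG2]] C0 hx t.
  have [t0|t0] := leP t 0.
    by rewrite ey1// ey2// subrr normr0 mulr_ge0// ?expR_ge0//; lra_from C0.
  have h1 : `|\sum_(j < p) A j *m (x1 (t - delay j) - x2 (t - delay j))| <=
      C / 4 * expR (lam * t).
    apply: (@le_trans _ _ (a * (C * expR (lam * (t - r))))).
      apply: aP => [j|]; last by rewrite mulr_ge0// expR_ge0.
      apply: le_trans (hx _) _; rewrite ler_wpM2l// ler_expR ler_wpM2l//.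
        by lra_from lam1.
      by rewrite lerD2l lerN2.
    rewrite mulrBr expRD expRN.
    have E0 := expR_gt0 (lam * r); have E1 := expR_ge0 (lam * t).
    rewrite (_ : a * _ = C / 4 * expR (lam * t) * (4 * a / expR (lam * r)));
      last by field; rewrite gt_eqF.
    by rewrite ler_piMr ?ler_pdivrMr ?mul1r// mulr_ge0//; lra_from C0.
  have h2 : `|G1 t - G2 t| <= C / 4 * expR (lam * t).
    apply: (exp_growth_le cG1 cG2 (dG1 t) (dG2 t) _ (ltW t0) C0 lamL).
      by rewrite G10 G20.
    move=> u hu; apply: F_lip; apply: (bnd_sgB cx1 cx2) => v hv.
    apply: le_trans (hx v) _; rewrite ler_wpM2l// ler_expR ler_wpM2l//.
      by lra_from lam1.
    by lra_from hv.
  rewrite yG1 ?yG2 ?(ltW t0)//.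
  have -> : forall u v w z q : 'cV[R]_n, (u + v + w) - (u + z + q) = (v - z) +
    (w - q).
    by move=> u v w z q; apply/matrixP => i j; rewrite !mxE; lra.
  rewrite -sumrB; under eq_bigr do rewrite -mulmxBr.
  apply: le_trans (ler_normD _ _) _; apply: le_trans (lerD h1 h2) _.
  by rewrite -mulrDl ler_wpM2r ?expR_ge0//; lra_from C0.
have /choice[step stepP] : forall x, exists y, admissible x -> admissible y /\
  picard x y.
  move=> x; have [ax|nax] := pselect (admissible x); last by exists x.
  by have [y hy] := picard_ex ax; exists y.
pose x_ k := iter k step phic.
have ax k : admissible (x_ k).
  elim: k => [|k IH]; last by case: (stepP _ IH).
  by split=> //; exact: phic_continuous.
have px k : picard (x_ k) (x_ k.+1) by case: (stepP _ (ax k)).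
(* The first increment grows at most affinely in [t], so it is finite in the weighted norm. *)
have [C C0 hC] : exists2 C, 0 <= C &
    forall t, `|x_ 1%N t - x_ 0%N t| <= C * expR (lam * t).
  have [M M0 hM] := hist_bnd Delta_gt0 phi.
  have pM t : `|phic t| <= M.
    apply: hM; rewrite /= le_max lexx/= ge_max ge_min lexx orbT andbT.
    lra_from D0.
  have [_ e1] := ax 1%N; have [G [cG G0 dG yG]] := px 0%N.
  pose F0 := F (hist0 n Delta).
  pose K := `|F0| + L * M.
  have K0 : 0 <= K by rewrite addr_ge0// mulr_ge0// ltW.
  pose C := `|neutral_op A delay phi| + a * M + M + K.
  have C0 : 0 <= C.
    by rewrite /C !addr_ge0// ?mulr_ge0// ltW.
  exists C => // t; have [t0|t0] := leP t 0.
    by rewrite e1// subrr normr0 mulr_ge0// expR_ge0.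
  have hG : `|G t| <= K * t.
    have := @rderiv_diff_le _ _ G _ (fun=> 0) (fun=> 0) t 0 t K cG _ (dG t).
    rewrite G0 !subr0; apply => //.
    + by move=> u; exact: cvg_cst.
    + move=> u hu e e0; exists 1 => // h /andP[h0 _].
      by rewrite scaler0 !subrr normr0 mulr_ge0// ltW.
    + exact: ltW.
    + move=> u hu; rewrite subr0 -(subrK F0 (F _)) addrC.
      apply: le_trans (ler_normD _ _) _; rewrite lerD2l; apply: F_lip => s hs.
      by rewrite /= subr0 (sgE _ phic_continuous hs); exact: pM.
  have hx : `|x_ 1%N t - x_ 0%N t| <=
      `|neutral_op A delay phi| + a * M + M + K * t.
    rewrite yG ?(ltW t0)//.
    have hs : `|\sum_(j < p) A j *m x_ 0%N (t - delay j)| <= a * M.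
      by apply: aP => [j|]; [exact: pM|exact: ltW].
    apply: le_trans (ler_normB _ _) _; have := pM t; rewrite -/(x_ 0%N t) => h3.
    apply: le_trans (lerD (le_trans (ler_normD _ _) (lerD (ler_normD _ _) hG))
      h3) _.
    by move: hs; lra.
  apply: le_trans hx _; have Et : 1 + t <= expR (lam * t).
    apply: le_trans (expR_ge1Dx _); rewrite lerD2l ler_peMl// ltW//.
  apply: le_trans (ler_wpM2l C0 Et); rewrite mulrDr mulr1 /C.
  have : 0 <= (C - K) * t.
    by rewrite mulr_ge0 ?(ltW t0)// /C addrK !addr_ge0// ?mulr_ge0// ltW.
  by rewrite /C; lra_from K0.
have hstep k t : `|x_ k.+1 t - x_ k t| <= C * expR (lam * t) / 2 ^+ k.
  suff H : forall t, `|x_ k.+1 t - x_ k t| <= C / 2 ^+ k * expR (lam * t).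
    by rewrite mulrAC; exact: H.
  elim: k => [|k IH] u; first by rewrite expr0 divr1; exact: hC.
  rewrite exprS invfM mulrA (mulrAC C).
  apply: (contract _ _ _ _ _ (ax k.+1) (ax k) (ax k.+2) (ax k.+1) (px k.+1) (px
    k)) => //.
  by rewrite divr_ge0// exprn_ge0.
have /choice[X hX] : forall t, exists l, forall k,
    `|x_ k t - l| <= 2 * (C * expR (lam * t)) / 2 ^+ k.
  by move=> t; apply: geometric_cauchy_vector => k; exact: hstep.
have cX : continuous X.
  apply/continuous_epsdelta => t e e0.
  have [k hk] := @geometric_small _ (2 * (C * expR (lam * (t + 1)))) (e / 3)
    ltac:(lra_from e0).
  have [cxk _] := ax k.
  have [d d0 hd] := (continuous_epsdelta (x_ k)).1 cxk t (e / 3) ltac:(lra_from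
    e0).
  exists (Num.min d 1); first by rewrite lt_min d0 ltr01.
  move=> u; rewrite lt_min => /andP[ud u1].
  have near v : v <= t + 1 -> `|x_ k v - X v| <= e / 3.
    move=> vt; apply: le_trans (hX v k) (le_trans _ hk).
    rewrite ler_wpM2r ?invr_ge0 ?exprn_ge0// ler_wpM2l// ler_wpM2l// ler_expR.
    by rewrite ler_wpM2l//; lra_from lam1.
  have n1 := near u ltac:(by move: u1; rewrite ltr_norml => /andP[_ h];
    lra_from h).
  have n2 := near t ltac:(by rewrite lerDl).
  have n3 := hd u ud; have := ler_distD (x_ k u) (X u) (X t).
  have := ler_distD (x_ k t) (x_ k u) (X t); rewrite (distrC (X u) (x_ k u)).
  by move=> m1 m2; lra_from n1 n2 n3 m1 m2.
have aX : admissible X.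
  split=> // t t0; apply/esym/(eq_of_geometric (c := 2 * (C * expR (lam * t))))
    => k.
  by have [_ e] := ax k; rewrite -e//; exact: hX.
(* The limit is shown to be its own image: by contraction the iterates also converge to [Y]. *)
have [Y [aY pY]] := picard_ex aX.
have XY t : X t = Y t.
  apply: (eq_of_geometric (c := 3 * (C * expR (lam * t)))) => k.
  have h1 := hX t k.+1.
  have h2 : `|x_ k.+1 t - Y t| <= 2 * C / 2 ^+ k / 2 * expR (lam * t).
    apply: (contract _ _ _ _ _ (ax k) aX (ax k.+1) aY (px k) pY).
      by rewrite divr_ge0 ?mulr_ge0// exprn_ge0.
    by move=> u; have := hX u k; rewrite !mulrA (mulrAC (2 * C)).
  have := ler_distD (x_ k.+1 t) (X t) (Y t); rewrite (distrC (X t) (x_ k.+1 t)).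
  have E0 : 0 <= C * expR (lam * t) / 2 ^+ k.
    by rewrite divr_ge0 ?mulr_ge0 ?expR_ge0 ?exprn_ge0.
  have e1 : 2 * (C * expR (lam * t)) / 2 ^+ k.+1 = C * expR (lam * t) / 2 ^+ k.
    by rewrite exprS; field; rewrite expf_neq0.
  have e2 : 2 * C / 2 ^+ k / 2 * expR (lam * t) = C * expR (lam * t) / 2 ^+ k.
    by field; rewrite expf_neq0.
  have e3 : 3 * (C * expR (lam * t)) / 2 ^+ k = 3 * (C * expR (lam * t) / 2 ^+
    k).
    by rewrite -mulrA.
  rewrite e3; move: h1 h2; rewrite e1 e2 => h1 h2 h3.
  by lra_from h1 h2 h3 E0.
have {XY}XY : X = Y by apply/funext.
move: pY; rewrite -XY => -[G [cG G0 dG eX]].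
exists X; split => // [t ht|b t ht e e0].
  by have [_ ->] := aX; [rewrite phicE|case/andP: ht].
have [d d0 hd] := dG b t ht e e0.
have nDX u : 0 <= u -> nD X u = neutral_op A delay phi + G u.
  by move=> u0; rewrite /nD {1}eX//; apply/matrixP => i j; rewrite !mxE; lra.
exists d => // h hh; rewrite !nDX; [|lra_from ht|lra_from ht hh].
by rewrite [_ + G (t + h)]addrC addrKA; exact: hd.
Qed.

End existence.

(** * The difference equation *)

Lemma max_delay_le (R : realType) (p : nat) (delay : 'I_p -> R) (Delta : R) :
  0 <= Delta -> (forall j, delay j <= Delta) -> max_delay delay <= Delta.
Proof. by move=> D0 h; apply: bigmax_le => // j _. Qed.

Lemma max_delay_ge0 (R : realType) (p : nat) (delay : 'I_p -> R) :
  0 <= max_delay delay.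
Proof. exact: bigmax_ge_id. Qed.

Section difference.
Variables (R : realType) (n p : nat) (Delta : R).
Variables (A : 'I_p -> 'M[R]_n) (delay : 'I_p -> R).
Hypothesis Delta_gt0 : 0 < Delta.
Hypothesis delayP : forall j, 0 < delay j <= Delta.
Implicit Types x y z : R -> 'cV[R]_n.
Local Notation sg := (seg Delta).
Local Notation nD := (neutral_diff A delay).
Local Notation rsol := (right_solution A delay).
Local Tactic Notation "lra_from" ne_hyp_list(hs) :=
  (clear - A Delta_gt0 delayP hs); lra.

(** By linearity [z] is rescaled to the sizes [d] and [b] at which [difference_uas] applies.
    Requiring [b / (2 * N)] after [T] produces the halving, where [N] pays for the change of
    norms. *)
Lemma homogeneous_decay : difference_uas A delay -> exists C T : R,
  [/\ 0 < C, 0 < T & forall z q, continuous z ->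
    (forall t, 0 <= t -> nD z t = 0) -> 0 < q ->
    (forall u, - Delta <= u <= 0 -> `|z u| <= q) ->
    (forall t, 0 <= t -> `|z t| <= C * q) /\
    (forall t, T <= t -> `|z t| <= q / 2)].
Proof.
have D0 := Delta_gt0.
case=> stab [b b0 attr]; pose N := Num.sqrt (n%:R : R) + 1.
have N0 : 0 < N by rewrite ltr_wpDl ?sqrtr_ge0.
have [d d0 hd] := stab 1 ltr01.
have [T T0 hT] := attr (b / (2 * N)) ltac:(by rewrite divr_gt0// mulr_gt0).
exists (N / d), T; split=> //; first exact: divr_gt0.
move=> z q cz z0 q0 hz.
have key s : 0 <= s -> difference_solution A delay 0 (fun t => s *: z t) /\
    supnorm (max_delay delay) (fun tau => s *: z (0 + tau)) <= N * (s * q).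
  move=> s0; split; first split.
  - by apply: continuous_subspaceT => t; apply: cvgZl_tmp; exact: cz.
  - move=> t t0; have := z0 t t0; rewrite /nD => /eqP;
      rewrite subr_eq0 => /eqP ->.
    by rewrite scaler_sumr; apply: eq_bigr => j _; rewrite scalemxAr.
  - have M0 := max_delay_ge0 delay.
    have MD : max_delay delay <= Delta.
      by apply: max_delay_le; [exact: ltW|move=> j; case/andP: (delayP j)].
    apply: (@le_trans _ _ (Num.sqrt n%:R * (s * q))).
      apply: supnorm_le_bnd => // u hu; rewrite add0r normrZ ger0_norm//
        ler_wpM2l//.
      by apply: hz; lra_from hu MD.
    by rewrite ler_wpM2r ?mulr_ge0 ?(ltW q0)// /N lerDl.
split=> t ht.
  have s0 : 0 < d / (N * q) by rewrite divr_gt0// mulr_gt0.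
  have [sol ini] := key _ (ltW s0).
  have := hd _ _ sol; rewrite (_ : N * (d / (N * q) * q) = d) in ini;
    last first.
    by field; rewrite !gt_eqF//.
  move=> /(_ ini t ht) h; have {h} := le_lt_trans (enorm_ge_norm _) h.
  rewrite normrZ gtr0_norm// => /ltW; rewrite mulrC -ler_pdivlMr//.
  by rewrite div1r invf_div mulrAC.
have s0 : 0 < b / (N * q) by rewrite divr_gt0// mulr_gt0.
have [sol ini] := key _ (ltW s0).
have := hT _ _ sol; rewrite (_ : N * (b / (N * q) * q) = b) in ini; last first.
  by field; rewrite !gt_eqF//.
move=> /(_ ini t); rewrite add0r => /(_ ht) h.
have {h} := le_lt_trans (enorm_ge_norm _) h.
rewrite normrZ gtr0_norm// => /ltW; rewrite mulrC -ler_pdivlMr//.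
rewrite (_ : b / (2 * N) / (b / (N * q)) = q / 2)//.
by field; rewrite !gt_eqF//.
Qed.

(** A crude bound with a factor [1 + a] per step of length [r]. It serves on a window of fixed
    length only, for the error between a function and its homogeneous part. *)
Lemma difference_growth a r x c t k : 0 <= a -> 0 < r ->
  (forall (v : 'I_p -> 'cV[R]_n) c,
    (forall j, `|v j| <= c) -> 0 <= c -> `|\sum_(j < p) A j *m v j| <= a * c) ->
  (forall j, r <= delay j) -> 0 <= c ->
  (forall u, - Delta <= u <= 0 -> `|x u| <= c) ->
  (forall u, 0 <= u <= t -> `|nD x u| <= c) ->
  - Delta <= t -> t <= k%:R * r -> `|x t| <= (1 + a) ^+ k * c.
Proof.
move=> a0 r0 aP rP c0 hx; elim: k t => [|k IH] t hn tD tk.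
  by rewrite expr0 mul1r; apply: hx; lra_from tD tk.
have K1 : 1 <= (1 + a) ^+ k by rewrite exprn_ege1//; lra_from a0.
have Kc : c <= (1 + a) ^+ k * c by rewrite ler_peMl.
have [t0|t0] := leP t 0.
  rewrite exprS -mulrA; apply: le_trans (hx t _) _; first by lra_from tD t0.
  by apply: le_trans Kc _; rewrite ler_peMl ?mulr_ge0// ?exprn_ge0//;
    lra_from a0.
rewrite exprS -mulrA mulrDl mul1r.
have -> : x t = nD x t + \sum_(j < p) A j *m x (t - delay j) by rewrite subrK.
apply: le_trans (ler_normD _ _) _; apply: lerD.
  by apply: le_trans Kc; apply: hn; lra_from t0.
apply: aP => [j|]; last by lra_from c0 Kc.
have := delayP j => dj; have := rP j => rj; apply: IH.
- by move=> u hu; apply: hn; lra_from hu dj.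
- by lra_from t0 dj.
- by move: tk; rewrite -natr1 mulrDl mul1r => tk; lra_from tk rj.
Qed.

(* Subtracting a ramp supported in [- r, 0], which no delay sees, makes the
   initial function satisfy the homogeneous equation at time [0]. *)
Lemma compatible_part y r : continuous y -> 0 < r -> (forall j, r <= delay j) ->
  exists z, [/\ continuous z, forall t, 0 <= t -> nD z t = 0 &
    forall u, - Delta <= u <= 0 -> `|y u - z u| <= `|nD y 0|].
Proof.
have D0 := Delta_gt0; move=> cy r0 rP.
pose ramp (u : R) : R := Num.max 0 (1 + u / r).
pose z0 u := y u - ramp u *: nD y 0.
have cz0 : continuous z0.
  move=> u; apply: cvgB; first exact: cy.
  apply: cvgZr_tmp; apply: (@continuous_max R R (fun=> 0) (fun u => 1 + u / r)
    u).
    exact: cvg_cst.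
  by apply: cvgD; [exact: cvg_cst|apply: cvgM; [exact: cvg_id|exact: cvg_cst]].
(* The homogeneous equation is the neutral equation with right-hand side 0, once the initial
   function is compatible. *)
have [z [cz ez sz]] := @rsol_exists R n p Delta A delay Delta_gt0 delayP
  (fun=> 0) 0 (lexx 0) (fun _ _ c _ => ltac:(by rewrite subrr normr0 mul0r)) (sg
    z0 0).
have {}ez u : - Delta <= u <= 0 -> z u = z0 u.
  by move=> hu; rewrite ez// (sgE _ cz0 hu) add0r.
exists z; split=> // [t t0|u hu].
  have nz0 : nD z 0 = 0.
    rewrite /nD ez; last by lra_from D0.
    rewrite /z0 (_ : ramp 0 = 1); last by rewrite /ramp mul0r addr0 max_r.
    rewrite scale1r /nD (_ : \sum_(j < p) A j *m z (0 - delay j) =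
      \sum_(j < p) A j *m y (0 - delay j)).
      by rewrite opprB [X in X - _]addrC subrK subrr.
    apply: eq_bigr => j _; have dj := delayP j; rewrite ez; last by lra_from dj.
    rewrite /z0 (_ : ramp _ = 0) ?scale0r ?subr0// /ramp max_l//.
    by rewrite sub0r mulNr subr_le0 ler_pdivlMr// mul1r.
  have := rsol_affine_le (w := 0) (c := 0) cz (sz t) (lexx 0) t0 (lexx t).
  rewrite nz0 scaler0 !subr0 mul0r normr_le0 => h.
  by apply/eqP; rewrite -normr_le0; exact: h.
rewrite ez// /z0 opprB addrC subrK normrZ ler_piMl// /ramp ger0_norm ?le_max
  ?lexx//.
by rewrite ge_max ler01/= gerDl pmulr_lle0 ?invr_gt0//; case/andP: hu.
Qed.

(** Write [y = z + (y - z)] with [z] from [compatible_part]. The first part is halved after a fixed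
    time; the second starts below [m], has the same [nD] as [y], and stays below a multiple of [m].
    The window is longer by [Delta] than the halving time, so that its whole last segment is
    covered. *)
Lemma difference_window : difference_uas A delay -> exists C T : R,
  [/\ 0 < C, 0 < T & forall y c m, continuous y -> 0 < c -> 0 <= m ->
    (forall u, - Delta <= u <= 0 -> `|y u| <= c) ->
    (forall t, 0 <= t <= T -> (forall u, 0 <= u <= t -> `|nD y u| <= m) ->
       `|y t| <= C * (c + m)) /\
    ((forall u, 0 <= u <= T -> `|nD y u| <= m) ->
       forall u, T - Delta <= u <= T -> `|y u| <= c / 2 + C * m)].
Proof.
have D0 := Delta_gt0; move=> /homogeneous_decay[C [T [C0 T0 hCT]]].
have [a a0 aP] := sum_mulmx_bound A.
have [r [r0 rD rP]] := min_delay D0 delayP.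
have [k hk] : exists k : nat, T + Delta <= k%:R * r.
  exists (Num.truncn ((T + Delta) / r)).+1; rewrite -ler_pdivrMr//; apply: ltW.
  exact: truncnS_gt.
pose K := (1 + a) ^+ k; have K0 : 0 <= K by rewrite exprn_ge0//; lra_from a0.
exists (C + K + 1), (T + Delta); split; [lra_from C0 K0|lra_from T0 D0|].
move=> y c m cy c0 m0 hy.
have [z [cz nz hyz]] := compatible_part cy r0 rP.
have main t : 0 <= t <= T + Delta -> (forall u, 0 <= u <= t -> `|nD y u| <= m)
  ->
    `|z t| <= C * (c + m) /\ `|y t - z t| <= K * m /\ (T <= t -> `|z t| <= (c +
      m) / 2).
  move=> /andP[t0 tT] hm.
  have hyz' u : - Delta <= u <= 0 -> `|y u - z u| <= m.
    by move=> hu; apply: le_trans (hyz u hu) _; apply: hm; rewrite lexx t0.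
  have hz u : - Delta <= u <= 0 -> `|z u| <= c + m.
    move=> hu; have -> : z u = y u - (y u - z u) by rewrite opprB addrC subrK.
    by apply: le_trans (ler_normB _ _) _; apply: lerD; [exact: hy|exact: hyz'].
  have [h1 h2] := hCT z (c + m) cz nz ltac:(lra_from c0 m0) hz.
  split; [exact: h1|split; last exact: h2].
  apply: (difference_growth (x := y \- z) a0 r0 aP rP m0 hyz').
  - by move=> u hu; rewrite nDB nz ?subr0; [exact: hm|case/andP: hu].
  - by lra_from t0 D0.
  - by lra_from tT hk.
have sub t : `|y t| <= `|z t| + `|y t - z t|.
  by have := ler_normD (z t) (y t - z t); rewrite [z t + _]addrC subrK.
split=> [t ht hm|hm u hu].
  have [h1 [h2 _]] := main t ht hm.
  apply: le_trans (sub t) _; apply: le_trans (lerD h1 h2) _.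
  have := mulr_ge0 K0 (ltW c0); lra_from c0 m0.
have hu' : 0 <= u <= T + Delta by lra_from hu T0 D0.
have [|_ [h2 h3]] := main u hu'.
  by move=> v hv; apply: hm; lra_from hv hu'.
have {}h3 := h3 ltac:(lra_from hu).
apply: le_trans (sub u) _; apply: le_trans (lerD h3 h2) _.
have := mulr_ge0 (ltW C0) m0; lra_from m0.
Qed.

(** [2 * C * m] is the fixed point of [e |-> e / 2 + C * m], so the bound [c / 2 ^+ k + 2 * C * m]
    reproduces itself from window to window. The larger constant [C'] also covers the times inside a
    window. *)
Lemma difference_iss : difference_uas A delay -> exists C T : R,
  [/\ 0 < C, 0 < T & forall y c m b, continuous y -> 0 < c -> 0 <= m ->
    (forall u, - Delta <= u <= 0 -> `|y u| <= c) ->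
    (forall u, 0 <= u <= b -> `|nD y u| <= m) ->
    (forall t, 0 <= t <= b -> `|y t| <= C * (c + m)) /\
    (forall k u, k%:R * T <= b -> k%:R * T - Delta <= u <= k%:R * T ->
       `|y u| <= c / 2 ^+ k + C * m)].
Proof.
have D0 := Delta_gt0; move=> /difference_window[C [T [C0 T0 hCT]]].
pose C' := C * (1 + 2 * C) + 2 * C.
have CC0 : 0 < C * C by exact: mulr_gt0.
have C'0 : 0 < C' by rewrite /C'; lra_from C0 CC0.
exists C', T; split=> // y c m b cy c0 m0 hy hm.
have e0 k : 0 < c / 2 ^+ k + 2 * C * m.
  by rewrite ltr_wpDr ?mulr_ge0 ?(ltW C0)// divr_gt0// exprn_gt0.
have e1 k : c / 2 ^+ k <= c.
  by rewrite ler_pdivrMr ?exprn_gt0// ler_peMr ?(ltW c0)// exprn_ege1// ler1n.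
have shiftH k u : k%:R * T <= b -> k%:R * T - Delta <= u <= k%:R * T ->
    `|y u| <= c / 2 ^+ k + 2 * C * m.
  elim: k u => [|k IH] u kb hu.
    rewrite expr0 divr1; apply: le_trans (hy u _) _; first by move: hu;
      rewrite mul0r sub0r.
    by rewrite lerDl !mulr_ge0// ltW.
  move: kb hu; rewrite -natr1 mulrDl mul1r => kb hu.
  have k0 : 0 <= k%:R * T by rewrite mulr_ge0// ltW.
  have [|_] := hCT (fun t => y (t + k%:R * T)) _ m (continuous_translate cy) (e0
    k) m0.
    by move=> v hv; apply: IH; [lra_from kb T0|lra_from hv].
  move=> /(_ _ (u - k%:R * T)); rewrite subrK => h.
  have {h} := h _ ltac:(lra_from hu); rewrite exprS invfM => h.
  apply: le_trans (h _) _; last by lra_from m0.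
  by move=> v hv; rewrite nD_shift; apply: hm; lra_from hv kb k0.
split=> [t ht|k u kb hu]; last first.
  apply: le_trans (shiftH k u kb hu) _; rewrite lerD2l ler_wpM2r// /C'.
  by lra_from C0 CC0.
pose k := Num.truncn (t / T).
have t0 : 0 <= t by case/andP: ht.
have kt : k%:R * T <= t by rewrite -ler_pdivlMr// truncn_le ?divr_ge0// ltW.
have tk : t <= k%:R * T + T.
  by have := truncnS_gt (t / T); rewrite ltr_pdivrMr// -natr1 mulrDl mul1r =>
    /ltW.
have k0 : 0 <= k%:R * T by rewrite mulr_ge0// ltW.
have kb : k%:R * T <= b by lra_from kt ht.
have [|h _] := hCT (fun t => y (t + k%:R * T)) _ m (continuous_translate cy) (e0
  k) m0.
  by move=> v hv; apply: shiftH => //; lra_from hv.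
have := h (t - k%:R * T); rewrite subrK => {}h.
apply: le_trans (h _ _) _.
- by lra_from kt tk.
- by move=> v hv; rewrite nD_shift; apply: hm; lra_from hv ht k0.
- have h1 := ler_wpM2l (ltW C0) (e1 k).
  have h2 : 0 <= C * C * c by rewrite mulr_ge0// ltW.
  have h3 : 0 <= C * m by rewrite mulr_ge0// ltW.
  rewrite /C'; have h4 : 0 <= C * c by rewrite mulr_ge0// ltW.
  by lra_from h1 h2 h3 h4.
Qed.

End difference.

(** * Upper derivative and solutions *)

Section limsup.
Variable R : realType.
Implicit Types (g : R -> R) (c : R).

Lemma limf_esup_right_le g c :
  (forall e, 0 < e -> exists2 d, 0 < d & forall h, 0 < h < d -> g h <= c + e) ->
  (limf_esup (fun h => (g h)%:E) (0 : R)^'+ <= c%:E)%E.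
Proof.
move=> hg; apply/lee_addgt0Pr => e e0; have [d d0 hd] := hg e e0.
rewrite limf_esupE; apply: (@le_trans _ _ (ereal_sup ((fun h => (g h)%:E) @`
  `]0, d[))).
  apply: ereal_inf_lbound; exists (`]0, d[%classic) => //.
  apply/nbhs_ballP; exists d => //= u; rewrite /ball/= sub0r normrN => ud u0.
  by rewrite in_itv/= u0; move: ud; rewrite gtr0_norm.
apply: ge_ereal_sup => _ [h /= + <-]; rewrite in_itv/= => hh.
by rewrite -EFinD lee_fin hd.
Qed.

Lemma limf_esup_rightP g c :
  (limf_esup (fun h => (g h)%:E) (0 : R)^'+ <= c%:E)%E ->
  forall e, 0 < e -> exists2 d, 0 < d & forall h, 0 < h < d -> g h <= c + e.
Proof.
move=> hg e e0.
have /ereal_inf_lt[_ [U /nbhs_ballP[d /= d0 hU] <-] hlt] :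
    (limf_esup (fun h => (g h)%:E) (0 : R)^'+ < (c + e)%:E)%E.
  by apply: le_lt_trans hg _; rewrite lte_fin ltrDl.
exists d => // h /andP[h0 hd]; rewrite -lee_fin; apply: le_trans (ltW hlt).
apply: ereal_sup_ubound; exists h => //; apply: hU => //.
by rewrite /ball/= sub0r normrN gtr0_norm.
Qed.

End limsup.

Section solutions.
Variables (R : realType) (n p : nat) (Delta : R).
Variables (A : 'I_p -> 'M[R]_n) (delay : 'I_p -> R).
Hypothesis Delta_gt0 : 0 < Delta.
Hypothesis delayP : forall j, 0 < delay j <= Delta.
Local Notation H := (hist n Delta).
Implicit Types (x y : R -> 'cV[R]_n) (phi psi : H) (F G : H -> 'cV[R]_n).
Local Notation sg := (seg Delta).
Local Notation nD := (neutral_diff A delay).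
Local Notation rsol := (right_solution A delay).
Local Tactic Notation "lra_from" ne_hyp_list(hs) :=
  (clear - A Delta_gt0 delayP hs); lra.

Lemma seg_segment x t : sg x t = segment Delta x t.
Proof. by rewrite seg.unlock. Qed.

(** For [h < r] the delayed terms of the continuation see only the past of [x], so they cancel
    against those of the solution. What remains at [s] is the first-order remainder of [nD x] over
    the time [s + h <= h]. *)
Lemma seg_sub_neutral_shift F x b t e : continuous x -> rsol F x b ->
  0 <= t < b -> 0 < e -> exists2 d, 0 < d & forall h, 0 < h < d ->
  bnd Delta (sg x (t + h) \- neutral_shift A delay F (sg x t) h) (e * h).
Proof.
have D0 := Delta_gt0; move=> cx sx ht e0.
have [r [r0 rD rP]] := min_delay D0 delayP.
have [d d0 hd] := sx t ht e e0.
exists (Num.min d r); first by rewrite lt_min d0.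
move=> h /andP[h0]; rewrite lt_min => /andP[hhd hr] s hs /=.
have hD : 0 < h < Delta by lra_from h0 hr rD.
rewrite (sgE _ cx hs) (neutral_shiftE _ _ _ delayP hD hs).
case: (leP s (- h)) => sh.
  have hs' : - Delta <= s + h <= 0 by lra_from hs sh h0.
  rewrite (sgE _ cx hs') (_ : t + (s + h) = t + h + s);
    last by rewrite addrCA addrC.
  by rewrite subrr normr0 mulr_ge0// ltW.
pose th := s + h; rewrite -/th.
have th0 : 0 < th by rewrite /th; lra_from sh.
have thh : th <= h by rewrite /th; lra_from hs.
have zD : - Delta <= (0 : R) <= 0 by lra_from D0.
have fE : neutral_op A delay (frozen_shift (sg x t) th) =
    sg x t 0 - \sum_(j < p) A j *m x (t + th - delay j).
  rewrite /neutral_op (frozen_shiftE _ D0 (ltW th0) zD).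
  rewrite (_ : (0 <= - th) = false); last by apply/negbTE; rewrite -ltNge;
    lra_from th0.
  congr (_ - _); apply: eq_bigr => j _.
  have dj := delayP j; have rj := rP j.
  have hj : - Delta <= - delay j <= 0 by lra_from dj.
  rewrite (frozen_shiftE _ D0 (ltW th0) hj) (_ : (- delay j <= - th) = true);
    last first.
    by lra_from thh hr rj.
  have hj' : - Delta <= - delay j + th <= 0 by lra_from dj rj thh hr th0.
  by rewrite (sgE _ cx hj') [- _ + _]addrC addrA.
rewrite fE (neutral_op_sg A Delta_gt0 delayP _ cx).
have -> : x (t + h + s) - (nD x t + th *: F (sg x t) -
    (sg x t 0 - \sum_(j < p) A j *m x (t + th - delay j)) + sg x t 0) =
    nD x (t + th) - nD x t - th *: F (sg x t).
  rewrite (_ : t + h + s = t + th); last by rewrite /th [s + h]addrC addrA.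
  rewrite [nD x (t + th)]/neutral_diff.
  by apply/matrixP => i j; rewrite !mxE; lra.
apply: le_trans (hd th _) _; first by lra_from th0 thh hhd.
by rewrite ler_wpM2l// ltW.
Qed.

Lemma continuous_lip_bounded_seg F x : lip_bounded F -> continuous x ->
  continuous (fun t => F (sg x t)).
Proof.
have D0 := Delta_gt0; move=> hF cx; apply/continuous_epsdelta => t e e0.
have [B B0 hB] := continuous_itv_bounded (t - Delta - 1) (t + 1) cx.
have [L L0 hL] := hF B.
have [d d0 hd] := sg_continuous Delta t cx (divr_gt0 (divr_gt0 e0 (ltr0Sn R 1))
  L0).
exists (Num.min d 1); first by rewrite lt_min d0 ltr01.
move=> u; rewrite lt_min => /andP[ud]; rewrite ltr_norml => u1.
apply: (@le_lt_trans _ _ (e / 2)); last by lra_from e0.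
have -> : e / 2 = L * (e / 2 / L) by rewrite [RHS]mulrC divfK// gt_eqF.
apply: hL; [apply: (bnd_sg cx)|apply: (bnd_sg cx)|exact: hd] => v hv; apply: hB.
- by lra_from hv u1.
- by lra_from hv u1.
Qed.

(** A continuous right derivative is a derivative: on either side of [t] the mean value inequality
    compares [nD x] with its tangent at [t]. *)
Lemma global_solution_of_rsol F x phi : lip_bounded F -> continuous x ->
  (forall t, - Delta <= t <= 0 -> x t = phi t) -> (forall b, rsol F x b) ->
  global_solution A delay F phi x.
Proof.
move=> hF cx xphi sx; have cF := continuous_lip_bounded_seg hF cx.
split; [exact: continuous_subspaceT|exact: xphi|].
exists (fun t => F (sg x t)); first exact: continuous_subspaceT.
move=> t t0; rewrite -!seg_segment; split=> //.
apply/cvgrPdist_le => e e0.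
have [d d0 hd] := (continuous_epsdelta _).1 cF t e e0.
apply/nbhs_ballP; exists d => //= s; rewrite /ball/= distrC => std st;
  rewrite in_itv/= andbT => s0.
rewrite -!seg_segment !(neutral_op_sg A Delta_gt0 delayP _ cx).
have st0 : s - t != 0 by rewrite subr_eq0.
have -> : F (sg x t) - (s - t)^-1 *: (nD x s - nD x t) =
    - (s - t)^-1 *: (nD x s - nD x t - (s - t) *: F (sg x t)).
  by rewrite [in RHS]scalerBr scalerA mulNr mulVf// scaleN1r opprK scaleNr
    addrC.
rewrite normrZ normrN normfV ler_pdivrMl ?normr_gt0// mulrC.
have [ts|st'] := leP t s.
  rewrite [`|s - t|]ger0_norm ?subr_ge0//.
  apply: (rsol_affine_le cx (sx s) t0 ts (lexx s)) => u hu; apply/ltW/hd.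
  by move: std; rewrite !ger0_norm; lra_from hu ts.
rewrite [`|s - t|]distrC [`|t - s|]ger0_norm ?subr_ge0 ?(ltW st')//.
have -> : nD x s - nD x t - (s - t) *: F (sg x t) =
   - (nD x t - nD x s - (t - s) *: F (sg x t)).
  set u := nD x s; set v := nD x t; set w := F _; clearbody u v w.
  by clear -u v w A Delta_gt0 delayP; apply/matrixP => i j; rewrite !mxE; lra.
rewrite normrN; apply: (rsol_affine_le cx (sx t) s0 (ltW st') (lexx t)) => u hu.
apply/ltW/hd; move: std; rewrite !ler0_norm; lra_from hu st'.
Qed.

(** Makes a solution continuous on the whole line without changing it where [global_solution]
    constrains it. *)
Definition clamp_left x (t : R) := x (Num.max (- Delta) t).

Lemma clamp_leftE x t : - Delta <= t -> clamp_left x t = x t.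
Proof. by move=> h; rewrite /clamp_left max_r. Qed.

Lemma clamp_left_continuous x : {within `[- Delta, +oo[, continuous x} ->
  continuous (clamp_left x).
Proof.
move=> /subspace_continuousP cx t.
pose c (u : R) : R := Num.max (- Delta) u.
have cD (u : R) : `[- Delta, +oo[%classic (c u) by rewrite /= in_itv/= andbT
  le_max lexx.
apply: cvg_trans (cx _ (cD t)).
suff: c u @[u --> t] --> within `[- Delta, +oo[ (nbhs (c t)).
  by move=> h; exact: (cvg_app x h).
have h : c u @[u --> t] --> nbhs (c t).
  by apply: (@continuous_max R R (fun=> - Delta) id t);
    [exact: cvg_cst|exact: cvg_id].
move=> B hB; have hB' : nbhs t (c @^-1` (fun v => `[- Delta, +oo[%classic v -> B
  v)).
  exact: (h _ hB).
by move: hB'; apply: filterS => u /= huB; exact: huB (cD u).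
Qed.

Lemma rsol_of_global_solution F x phi : global_solution A delay F phi x ->
  [/\ continuous (clamp_left x),
    forall t, - Delta <= t <= 0 -> clamp_left x t = phi t &
    forall b, rsol F (clamp_left x) b].
Proof.
have D0 := Delta_gt0; move=> [cx xphi [dDx _ hD]].
have cc := clamp_left_continuous cx.
split=> // [t ht|b t /andP[t0 tb] e e0].
  by rewrite clamp_leftE ?xphi//; case/andP: ht.
have segE u : 0 <= u -> segment Delta x u = sg (clamp_left x) u.
  move=> u0; apply: hist_ext => s /= hs; move: hs; rewrite in_itv/= => hs.
  rewrite (segmentE cx u0 hs) (sgE _ cc hs) clamp_leftE//; lra_from hs u0.
have [lim dE] := hD t t0.
have /cvgrPdist_le/(_ e e0)/nbhs_ballP[d /= d0 hd] := lim.
exists d => // h /andP[h0 hhd].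
have := hd (t + h); rewrite /ball/= distrC [t + h - t]addrC addKr gtr0_norm//.
rewrite in_itv/= andbT => /(_ hhd).
have th : t + h != t by rewrite -subr_eq0 [t + h - t]addrC addKr gt_eqF.
have th0 : 0 <= t + h by rewrite addr_ge0// ltW.
move=> /(_ th th0); rewrite dE !segE// !(neutral_op_sg A Delta_gt0 delayP _ cc)
  => hh.
set u := nD _ _ - nD _ _ in hh *.
have -> : u - h *: F (sg (clamp_left x) t) = h *: (h^-1 *: u - F (sg (clamp_left
  x) t)).
  by rewrite scalerBr scalerA divff ?scale1r// gt_eqF.
by rewrite normrZ gtr0_norm// mulrC ler_wpM2r ?(ltW h0)// distrC.
Qed.

End solutions.

(** * Sufficiency *)

Section class_K.
Variable R : realType.
Implicit Types (alpha : R -> R) (s t e : R).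

Lemma class_K_le alpha s t : class_K alpha -> 0 <= s -> s <= t ->
  alpha s <= alpha t.
Proof.
case=> _ _ _ mono s0; rewrite le_eqVlt => /predU1P[->//|st].
exact/ltW/mono.
Qed.

Lemma class_K_lt_inv alpha s t : class_K alpha -> 0 <= s -> 0 <= t ->
  alpha s < alpha t -> s < t.
Proof.
move=> hK s0 t0 h; rewrite ltNge; apply/negP => ts.
by have := class_K_le hK t0 ts; rewrite leNgt h.
Qed.

Lemma class_K_gt0 alpha s : class_K alpha -> 0 < s -> 0 < alpha s.
Proof. by case=> _ _ a0 mono s0; rewrite -a0; exact: mono. Qed.

Lemma class_K_small alpha e : class_K alpha -> 0 < e ->
  exists2 d, 0 < d & forall s, 0 <= s <= d -> alpha s < e.
Proof.
case=> pos /subspace_continuousP ca a0 mono e0.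
have /cvgrPdist_lt/(_ e e0)/nbhs_ballP[d /= d0 hd] :=
  ca 0 ltac:(by rewrite /= in_itv/= lexx).
exists (d / 2); first by rewrite divr_gt0.
move=> s /andP[s0 sd]; have := hd s; rewrite /ball/= sub0r normrN ger0_norm//.
move=> /(_ ltac:(lra)); rewrite in_itv/= andbT => /(_ s0).
by rewrite /from_subspace a0 sub0r normrN ger0_norm// pos.
Qed.

End class_K.

Section clamp.
Variables (R : realType) (n : nat) (Delta : R).
Hypothesis Delta_gt0 : 0 < Delta.
Variable B : R.
Hypothesis B_ge0 : 0 <= B.

(** Truncation by coordinates is a retraction onto the ball of the max norm, and is 1-Lipschitz for
    that norm. *)
Definition clamp (v : 'cV[R]_n) : 'cV[R]_n :=
  \col_i Num.max (- B) (Num.min (v i 0) B).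

Lemma clamp_norm v : `|clamp v| <= B.
Proof.
have B0 := B_ge0; apply: norm_le_coord => // i.
by rewrite mxE ler_norml le_max lexx/= ge_max ge_min lexx orbT andbT; lra.
Qed.

Lemma clamp_id v : `|v| <= B -> clamp v = v.
Proof.
move=> vB; apply/matrixP => i j; rewrite ord1 mxE.
have := le_trans (coord_le_norm v i) vB; rewrite ler_norml => /andP[h1 h2].
by rewrite min_l// max_r.
Qed.

Let maxr_lip (c a b : R) : `|Num.max c a - Num.max c b| <= `|a - b|.
Proof.
have h1 : a - b <= `|a - b| by exact: ler_norm.
have h2 : b - a <= `|a - b| by rewrite distrC; exact: ler_norm.
by rewrite ler_norml; case: (leP c a) => ?; case: (leP c b) => ?; lra.
Qed.

Let minr_lip (c a b : R) : `|Num.min a c - Num.min b c| <= `|a - b|.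
Proof.
have h1 : a - b <= `|a - b| by exact: ler_norm.
have h2 : b - a <= `|a - b| by rewrite distrC; exact: ler_norm.
by rewrite ler_norml; case: (leP a c) => ?; case: (leP b c) => ?; lra.
Qed.

Lemma clamp_lip v w : `|clamp v - clamp w| <= `|v - w|.
Proof.
apply: norm_le_coord => // i; rewrite !mxE.
apply: le_trans (maxr_lip _ _ _) (le_trans (minr_lip _ _ _) _).
by have := coord_le_norm (v - w) i; rewrite !mxE.
Qed.

End clamp.

Lemma bnd_supnorm_hist (R : realType) (n : nat) (Delta : R) (phi : hist n Delta)
  :
  0 < Delta -> bnd Delta phi (supnorm Delta phi).
Proof.
move=> D0; have -> : hist_fun phi = phi \- hist0 n Delta.
  by apply/funext => s; rewrite /= subr0.
exact: bnd_supnorm.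
Qed.

(** * From the functional to 0-GAS *)

Section sufficiency.
Variables (R : realType) (n p : nat) (Delta : R).
Variables (A : 'I_p -> 'M[R]_n) (delay : 'I_p -> R).
Hypothesis Delta_gt0 : 0 < Delta.
Hypothesis delayP : forall j, 0 < delay j <= Delta.
Local Notation H := (hist n Delta).
Variable f : H -> 'cV[R]_n.
Hypothesis f_lip : lip_bounded f.
Hypothesis A_uas : difference_uas A delay.
Variables (V : H -> R) (alpha1 alpha2 alpha3 : R -> R).
Hypothesis V_ge0 : forall phi, 0 <= V phi.
Hypothesis V_lip : locally_lipschitz V.
Hypothesis alpha1P : class_Kinf alpha1.
Hypothesis alpha2P : class_Kinf alpha2.
Hypothesis alpha3P : class_K alpha3.
Hypothesis V_lower : forall phi, alpha1 (enorm (neutral_op A delay phi)) <= V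
  phi.
Hypothesis V_upper : forall phi : H, V phi <= alpha2 (supnorm Delta phi).
Hypothesis V_deriv : forall phi, (upper_derivative A delay f V phi
             <= (- alpha3 (enorm (neutral_op A delay phi)))%:E)%E.
Implicit Types (x y : R -> 'cV[R]_n) (phi psi : H) (F G : H -> 'cV[R]_n).
Local Notation sg := (seg Delta).
Local Notation nD := (neutral_diff A delay).
Local Notation rsol := (right_solution A delay).
Local Notation N := (Num.sqrt (n%:R : R) + 1).
Local Tactic Notation "lra_from" ne_hyp_list(hs) :=
  (clear - A_uas Delta_gt0 delayP f_lip V_ge0 V_lip alpha1P alpha2P alpha3P
    V_lower V_upper V_deriv hs); lra.

Let N_gt0 : 0 < N. Proof. by rewrite ltr_wpDl ?sqrtr_ge0. Qed.

Let supnorm_le (g : R -> 'cV[R]_n) c : 0 <= c -> bnd Delta g c ->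
  supnorm Delta g <= N * c.
Proof.
move=> c0 hg; apply: le_trans (supnorm_le_bnd (ltW Delta_gt0) hg) _.
by rewrite ler_wpM2r// lerDl.
Qed.

Lemma locally_lipschitz_bnd phi : exists H0 L, [/\ 0 < H0, 0 < L &
  forall phi1 phi2 c, bnd Delta (phi1 \- phi) H0 -> bnd Delta (phi2 \- phi) H0
    ->
  bnd Delta (phi1 \- phi2) c -> `|V phi1 - V phi2| <= L * c].
Proof.
have [H0 [L [H00 L0 hL]]] := V_lip phi.
have H1 : 0 < H0 / N by rewrite divr_gt0.
exists (H0 / N), (L * N); split => //; first exact: mulr_gt0.
have hb psi : bnd Delta (psi \- phi) (H0 / N) -> supnorm Delta (psi \- phi) <=
  H0.
  move=> h; apply: le_trans (supnorm_le (ltW H1) h) _.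
  by rewrite mulrC divfK// gt_eqF.
move=> phi1 phi2 c h1 h2 h12; apply: le_trans (hL _ _ (hb _ h1) (hb _ h2)) _.
rewrite -mulrA ler_wpM2l ?(ltW L0)//; apply: (supnorm_le _ h12).
exact: (bnd_ge0 Delta_gt0 h12).
Qed.

Lemma continuous_V_seg x : continuous x -> continuous (fun t => V (sg x t) :
  R^o).
Proof.
move=> cx; apply/continuous_epsdelta => t e e0.
have [H0 [L [H00 L0 hL]]] := locally_lipschitz_bnd (sg x t).
pose e' := Num.min H0 (e / 2 / L).
have e'0 : 0 < e' by rewrite lt_min H00 !divr_gt0.
have [d d0 hd] := sg_continuous Delta t cx e'0; exists d => // u ut.
have hu := hd u ut.
have Le : L * e' <= e / 2 by rewrite mulrC -ler_pdivlMr// ge_min lexx orbT.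
apply: (@le_lt_trans _ _ (L * e')); last by lra_from Le e0.
apply: hL => //; first by apply: bnd_le hu; rewrite ge_min lexx.
by move=> s hs /=; rewrite subrr normr0 ltW.
Qed.

(** Half of [e] is the slack of the upper limit, the other half pays for replacing the shift by the
    solution, at distance [e1 * h] with [L * e1 = e / 2]. The bounds [d2] and [d4] keep the solution
    and the shift in the ball where [V] is Lipschitz. *)
Lemma V_decrease x b t e : continuous x -> rsol f x b -> 0 <= t < b -> 0 < e ->
  exists2 d, 0 < d & forall h, 0 < h < d ->
  V (sg x (t + h)) <= V (sg x t) + (- alpha3 (enorm (nD x t)) + e) * h.
Proof.
move=> cx sx ht e0.
have [H0 [L [H00 L0 hL]]] := locally_lipschitz_bnd (sg x t).
pose e1 := e / 2 / L.
have e10 : 0 < e1 by rewrite !divr_gt0.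
have [d1 d10 hd1] := seg_sub_neutral_shift Delta_gt0 delayP cx sx ht e10.
have H02 : 0 < H0 / 2 by lra_from H00.
have [d2 d20 hd2] := sg_continuous Delta t cx H02.
have e20 : 0 < e / 2 by lra_from e0.
have [d3 d30 hd3] := limf_esup_rightP (V_deriv (sg x t)) e20.
pose d4 := H0 / 2 / e1; have d40 : 0 < d4 by rewrite divr_gt0.
exists (Num.min (Num.min d1 d2) (Num.min d3 d4)).
  by rewrite !lt_min d10 d20 d30 d40.
move=> h /andP[h0]; rewrite !lt_min => /andP[/andP[hh1 hh2] /andP[hh3 hh4]].
have b1 := hd1 h ltac:(by rewrite h0).
have b2 : bnd Delta (sg x (t + h) \- sg x t) (H0 / 2).
  by apply: hd2; rewrite [t + h]addrC addrK gtr0_norm.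
have b2' : bnd Delta (sg x (t + h) \- sg x t) H0.
  by apply: (bnd_le _ b2); lra_from H00.
have e1h : e1 * h <= H0 / 2 by rewrite mulrC -ler_pdivlMr// ltW.
have := hd3 h ltac:(by rewrite h0); rewrite ler_pdivrMr//.
rewrite (neutral_op_sg A Delta_gt0 delayP _ cx).
set ns := neutral_shift A delay f (sg x t) h in b1 *; clearbody ns.
move=> k1.
have b3 : bnd Delta (ns \- sg x t) H0.
  move=> s hs; have := b1 s hs; have := b2 s hs; rewrite /=.
  set u := sg x (t + h) s; set v := ns s; set w := sg x t s.
  move=> h2 h1; have h3 := ler_distD u v w; rewrite (distrC v u) in h3.
  by lra_from h1 h2 h3 e1h.
have := hL (sg x (t + h)) ns (e1 * h) b2' b3 b1; rewrite mulrA.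
rewrite (_ : L * e1 = e / 2); last by rewrite /e1 mulrC divfK// gt_eqF.
rewrite ler_norml => /andP[_ k2]; lra_from k1 k2.
Qed.

Lemma V_energy x b s t eta : continuous x -> rsol f x b -> 0 <= s -> s <= t ->
  t <= b -> 0 <= eta -> (forall u, s <= u < t -> eta <= enorm (nD x u)) ->
  V (sg x t) <= V (sg x s) - alpha3 eta * (t - s).
Proof.
move=> cx sx s0 st tb eta0 hu; rewrite -mulNr.
apply: (dini_le (continuous_V_seg cx) st) => u hu' e e0.
have [d d0 hd] := V_decrease cx sx (t := u) ltac:(lra_from hu' s0 tb) e0.
exists d => // h hh; apply: le_trans (hd h hh) _.
rewrite lerD2l ler_wpM2r//; first by case/andP: hh => /ltW.
by rewrite lerD2r lerN2; apply: class_K_le => //; exact: hu.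
Qed.

Lemma V_nonincreasing x b s t : continuous x -> rsol f x b -> 0 <= s -> s <= t
  ->
  t <= b -> V (sg x t) <= V (sg x s).
Proof.
move=> cx sx s0 st tb; have [_ _ a0 _] := alpha3P.
have := V_energy cx sx s0 st tb (lexx 0) (fun u _ => sqrtr_ge0 _).
by rewrite a0 mul0r subr0.
Qed.

Lemma V_seg_le x t c : continuous x -> 0 <= c ->
  (forall u, t - Delta <= u <= t -> `|x u| <= c) -> V (sg x t) <= alpha2 (N *
    c).
Proof.
move=> cx c0 hx; apply: le_trans (V_upper _) _.
have hb := bnd_sg cx hx; apply: class_K_le (supnorm_le c0 hb);
  first by case: alpha2P.
exact: (bnd_ge0 Delta_gt0 (bnd_supnorm_hist _ Delta_gt0)).
Qed.

(** Along the solution [alpha1 (enorm (nD x u)) <= V <= alpha2 (N * c) < alpha1 m], so [D x_t] stays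
    below [m] and [difference_iss] applies. [C] does not depend on [c] and [m], which allows
    [local_stability] to take both small. *)
Lemma a_priori_bound : exists2 C, 0 < C & forall x b c m, continuous x ->
  rsol f x b -> 0 < c -> 0 <= m -> alpha2 (N * c) < alpha1 m ->
  (forall u, - Delta <= u <= 0 -> `|x u| <= c) ->
  forall t, 0 <= t <= b -> `|x t| <= C * (c + m).
Proof.
have [C [T [C0 _ hC]]] := difference_iss Delta_gt0 delayP A_uas.
have [a1K _] := alpha1P.
exists C => // x b c m cx sx c0 m0 cm hx t ht.
have [|h _] := hC x c m b cx c0 m0 hx; last exact: h.
move=> u hu; apply: le_trans (enorm_ge_norm _) _; apply/ltW.
apply: (class_K_lt_inv a1K) => //; first exact: sqrtr_ge0.
apply: le_lt_trans cm; rewrite -(neutral_op_sg A Delta_gt0 delayP _ cx).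
apply: le_trans (V_lower _) _.
apply: (le_trans (V_nonincreasing cx sx (lexx 0) _ _)); [by case/andP: hu..|].
apply: V_seg_le => //; first exact: ltW.
by move=> v; rewrite sub0r; exact: hx.
Qed.

Lemma global_existence_bound c : 0 < c -> exists2 K, 0 < K &
  (forall xi : H, bnd Delta xi c -> exists x, global_solution A delay f xi x) /\
  (forall x b, continuous x -> rsol f x b ->
    (forall u, - Delta <= u <= 0 -> `|x u| <= c) ->
    forall t, - Delta <= t <= b -> `|x t| <= K).
Proof.
have D0 := Delta_gt0.
move=> c0; have [C C0 hC] := a_priori_bound.
have [_ /(_ (alpha2 (N * c)))[m m0 hm]] := alpha1P.
pose K := C * (c + m) + c.
have Cm0 : 0 <= C * (c + m) by rewrite mulr_ge0// ?(ltW C0)//; lra_from c0 m0.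
have K0 : 0 < K by rewrite /K; lra_from Cm0 c0.
have bound x b : continuous x -> rsol f x b ->
    (forall u, - Delta <= u <= 0 -> `|x u| <= c) ->
    forall t, - Delta <= t <= b -> `|x t| <= K.
  move=> cx sx hx t ht; have [t0|t0] := leP t 0.
    by apply: le_trans (hx t _) _; [lra_from ht t0|rewrite /K; lra_from Cm0].
  apply: le_trans (hC x b c m cx sx c0 m0 hm hx t _) _; first by lra_from ht t0.
  by rewrite /K lerDl ltW.
exists K => //; split=> // xi hxi.
(* As long as the solution of the truncated equation stays below [B], it solves
   the original one, hence stays below [K < B]. *)
pose B := K + 1; have B0 : 0 <= B by rewrite /B; lra_from K0.
have [L L0 hL] := f_lip B.
pose xic (psi : H) (t : R) := clamp B (psi (Num.max (- Delta) (Num.min t 0))).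
have cxic psi : continuous (xic psi).
  have ch := hist_clamp_continuous (phi := psi) D0.
  apply/continuous_epsdelta => t e e0.
  have [d d0 hd] := (continuous_epsdelta _).1 ch t e e0.
  exists d => // u ut; apply: le_lt_trans (hd u ut); exact: clamp_lip.
pose trunc (psi : H) := sg (xic psi) 0.
have truncE psi s : - Delta <= s <= 0 -> trunc psi s = clamp B (psi s).
  move=> hs; rewrite /trunc (sgE _ (cxic psi) hs) add0r /xic min_l ?max_r//.
  - by case/andP: hs.
  - by case/andP: hs.
have lipf (phi psi : H) q : bnd Delta (phi \- psi) q ->
    `|f (trunc phi) - f (trunc psi)| <= L * q.
  move=> hq; apply: hL => s hs.
  - by rewrite truncE// clamp_norm.
  - by rewrite truncE// clamp_norm.
  - by rewrite /= !truncE//; apply: le_trans (clamp_lip _ _ _) (hq s hs).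
have [x [cx exi sx]] := @rsol_exists R n p Delta A delay Delta_gt0 delayP
  (fun psi => f (trunc psi)) L (ltW L0) lipf xi.
have hx u : - Delta <= u <= 0 -> `|x u| <= c by move=> hu; rewrite exi//;
  exact: hxi.
have untrunc b : (forall u, - Delta <= u <= b -> `|x u| <= B) -> rsol f x b.
  move=> hB t ht e e0; have [d d0 hd] := sx b t ht e e0; exists d => // h hh.
  have -> : sg x t = trunc (sg x t); last exact: hd.
  apply: hist_ext => s; rewrite /= in_itv/= => hs.
  by rewrite truncE// clamp_id// (sgE _ cx hs); apply: hB; lra_from hs ht.
(* Continuous induction: the bound [K] up to [t0] gives [K + 1 = B] slightly later by continuity,
   and the a priori bound improves this back to [K]. *)
have xK t : 0 <= t -> `|x t| <= K.
  apply: (real_ind (P := fun t => `|x t| <= K)).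
  - by apply: le_trans (hx 0 _) _; [lra_from D0|rewrite /K; lra_from Cm0].
  - move=> t0 t00 IH; have [d d0 hd] := (continuous_epsdelta _).1 cx t0 1 ltr01.
    exists d => // s hs.
    apply: (bound x s cx) => //; last by rewrite lexx andbT; lra_from hs t00 D0.
    apply: untrunc => u hu; have [u0|u0] := leP u 0.
      by apply: le_trans (hx u _) _; [lra_from hu u0|rewrite /B /K;
        lra_from Cm0].
    have [ut|ut] := leP u t0.
      by apply: le_trans (IH u _) _; [lra_from u0 ut|rewrite /B lerDl].
    have h1 := hd u ltac:(by rewrite ger0_norm; lra_from ut hu hs).
    have h2 := IH t0 ltac:(by rewrite t00 lexx).
    have := ler_distD (x t0) (x u) 0; rewrite !subr0 /B => h3.
    by lra_from h1 h2 h3.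
  - move=> t0 t00 IH; have [d d0 hd] := (continuous_epsdelta _).1 cx t0 (1 / 2)
      ltac:(lra_from K0).
    apply: (bound x t0 cx) => //; last by rewrite lexx andbT; lra_from t00 D0.
    apply: untrunc => u hu; have [u0|u0] := leP u 0.
      by apply: le_trans (hx u _) _; [lra_from hu u0|rewrite /B /K;
        lra_from Cm0].
    have [ut|ut] := ltP u t0.
      by apply: le_trans (IH u _) _; [lra_from u0 ut|rewrite /B lerDl].
    have -> : u = t0 by lra_from hu ut.
    pose s := Num.max 0 (t0 - d / 2).
    have s0 : 0 <= s by rewrite le_max lexx.
    have s2 : t0 - d / 2 <= s by rewrite le_max lexx orbT.
    have st : s < t0 by rewrite gt_max; apply/andP; split; lra_from t00 d0.
    have h1 := hd s ltac:(by rewrite ler0_norm; lra_from s2 st d0).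
    have h2 := IH s ltac:(by rewrite s0 st).
    have := ler_distD (x s) (x t0) 0; rewrite !subr0 (distrC (x t0) (x s)) /B =>
      h3.
    by lra_from h1 h2 h3.
exists x; apply: (global_solution_of_rsol Delta_gt0 delayP f_lip cx exi) => b.
apply: untrunc => u hu; have [u0|u0] := leP u 0.
  by apply: le_trans (hx u _) _; [lra_from hu u0|rewrite /B /K; lra_from Cm0].
by apply: le_trans (xK u (ltW u0)) _; rewrite /B lerDl.
Qed.

Lemma local_stability e : 0 < e -> exists2 d, 0 < d &
  forall x b, continuous x -> rsol f x b ->
    (forall u, - Delta <= u <= 0 -> `|x u| <= d) ->
    forall t, 0 <= t <= b -> `|x t| < e.
Proof.
move=> e0; have [C C0 hC] := a_priori_bound.
have [a1K _] := alpha1P; have [a2K _] := alpha2P.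
pose m := e / 4 / C; have m0 : 0 < m by rewrite !divr_gt0.
have [d d0 hd] := class_K_small a2K (class_K_gt0 a1K m0).
pose d' := Num.min (d / N) m.
have d'0 : 0 < d' by rewrite lt_min m0 divr_gt0.
exists d' => // x b cx sx hx t ht.
apply: le_lt_trans (hC x b d' m cx sx d'0 (ltW m0) _ hx t ht) _.
  apply: hd; rewrite mulr_ge0 ?(ltW d'0) ?(ltW N_gt0)//=.
  by rewrite mulrC -ler_pdivlMr// ge_min lexx.
have h1 : C * (d' + m) <= C * (m + m).
  by rewrite ler_wpM2l ?(ltW C0)// lerD2r ge_min lexx orbT.
have h2 : C * m = e / 4 by rewrite mulrC divfK// gt_eqF.
by apply: le_lt_trans h1 _; rewrite mulrDr h2; lra_from e0.
Qed.

Lemma uniform_attraction c e : 0 < c -> 0 < e -> exists2 T, 0 < T &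
  forall x, continuous x -> (forall b, rsol f x b) ->
    (forall u, - Delta <= u <= 0 -> `|x u| <= c) ->
    forall t, T <= t -> `|x t| < e.
Proof.
have D0 := Delta_gt0; move=> c0 e0.
have [K K0 [_ hK]] := global_existence_bound c0.
have [d d0 hd] := local_stability e0.
have [C [T [C0 T0 hC]]] := difference_iss Delta_gt0 delayP A_uas.
have [L L0 hL] := f_lip K.
pose M := L * K + `|f (hist0 n Delta)| + 1.
have M0 : 0 < M by rewrite ltr_wpDl// addr_ge0// mulr_ge0// ltW.
have d20 : 0 < d / 2 by lra_from d0.
(* After [k] blocks of length [T] with [|nD x| <= eta], the solution is below
   [K / 2 ^+ k + C * eta <= d] on a whole segment, where [local_stability] takes over. This fixes
   [k] and [eta]. *)
have [k hk] := geometric_small K d20.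
pose eta := d / 2 / C; have eta0 : 0 < eta by rewrite divr_gt0.
(* [nD x] is [M]-Lipschitz, so it exceeds [eta / 2] during a time [lag] after it
   exceeds [eta]. *)
pose lag := eta / 2 / M; have lag0 : 0 < lag by rewrite !divr_gt0.
pose W := k%:R * T; have W0 : 0 <= W by rewrite mulr_ge0// ltW.
pose kap := alpha3 (eta / 2) * lag.
have kap0 : 0 < kap.
  by rewrite mulr_gt0//; apply: class_K_gt0; [|rewrite divr_gt0].
(* With [m] windows in which [|nD x|] exceeds [eta] somewhere, [V] would lose more than its initial
   value. *)
pose m := (Num.truncn (alpha2 (N * c) / kap)).+1.
have hm : alpha2 (N * c) < m%:R * kap.
  by rewrite -ltr_pdivrMr//; exact: truncnS_gt.
have Wl0 : 0 < W + lag by lra_from W0 lag0.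
exists (m%:R * (W + lag)); first by rewrite mulr_gt0.
move=> x cx sx hx t ht.
have xK u : - Delta <= u -> `|x u| <= K.
  by move=> hu; apply: (hK x u cx (sx u) hx); rewrite hu lexx.
have dLip s u : 0 <= s -> s <= u -> `|nD x u - nD x s| <= M * (u - s).
  move=> s0 su; have := rsol_affine_le (w := 0) (c := M) cx (sx u) s0 su (lexx
    u).
  rewrite scaler0 subr0; apply => v hv; rewrite subr0.
  apply: (@le_trans _ _ (L * K + `|f (hist0 n Delta)|)); last by rewrite lerDl.
  rewrite -[f (sg x v)](subrK (f (hist0 n Delta))).
  apply: le_trans (ler_normD _ _) _; rewrite lerD2r; apply: hL.
  - by apply: (bnd_sg cx) => w hw; apply: xK; lra_from hw hv s0.
  - by move=> w _; rewrite normr0 ltW.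
  - move=> w hw; rewrite /= subr0; apply: (bnd_sg cx) hw => w' hw'.
    by apply: xK; lra_from hw' hv s0.
have good i : (forall u, i%:R * (W + lag) <= u <= i%:R * (W + lag) + W ->
    `|nD x u| <= eta) -> i%:R * (W + lag) + W <= t -> `|x t| < e.
  set a := i%:R * (W + lag) => ha at_.
  have a0 : 0 <= a by rewrite mulr_ge0// ltW.
  have := hC (fun u => x (u + a)) K eta W (continuous_translate cx) K0 (ltW
    eta0).
  case=> [u hu|u hu|_ hd'].
  - by apply: xK; lra_from hu a0.
  - by rewrite nD_shift; apply: ha; lra_from hu.
  have hist_d u : W - Delta <= u <= W -> `|x (u + a)| <= d.
    move=> hu; apply: le_trans (hd' k u (lexx _) hu) _.
    have : C * eta = d / 2 by rewrite mulrC divfK// gt_eqF.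
    by move=> ->; lra_from hk.
  have aW0 : 0 <= a + W by lra_from a0 W0.
  have := hd (fun u => x (u + (a + W))) (t - (a + W)) (continuous_translate cx).
  move=> /(_ (rsol_shift cx aW0 (sx _)))h.
  have {h} := h _ (t - (a + W)); rewrite subrK; apply.
  - by move=> u hu; rewrite [a + W]addrC addrA; apply: hist_d; lra_from hu.
  - by rewrite lexx subr_ge0 at_.
have [[i im]|bad] := pselect (exists2 i, (i < m)%N &
    forall u, i%:R * (W + lag) <= u <= i%:R * (W + lag) + W -> `|nD x u| <=
      eta).
  move=> h; apply: (good i h); apply: le_trans ht.
  have : i.+1%:R * (W + lag) <= m%:R * (W + lag) by rewrite ler_pM2r// ler_nat.
  by rewrite -natr1 mulrDl mul1r => h1; lra_from h1 lag0.
have dec i : (i <= m)%N -> V (sg x (i%:R * (W + lag))) <= V (sg x 0) - i%:R *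
  kap.
  elim: i => [_|i IH im]; first by rewrite !mul0r subr0.
  set a := i%:R * (W + lag).
  have a0 : 0 <= a by rewrite mulr_ge0// ltW.
  have [u hu etau] : exists2 u, a <= u <= a + W & eta < `|nD x u|.
    apply: contrapT => h; apply: bad; exists i => // u hu.
    by rewrite leNgt; apply/negP => hu'; apply: h; exists u.
  have e1 : i.+1%:R * (W + lag) = a + W + lag by rewrite -natr1 mulrDl mul1r
    addrA.
  rewrite e1.
  have u0 : 0 <= u by lra_from hu a0.
  have h1 : V (sg x (a + W + lag)) <= V (sg x (u + lag)).
    by apply: (V_nonincreasing cx (sx _) _ _ (lexx _)); lra_from hu u0 lag0.
  have h2 : V (sg x (u + lag)) <= V (sg x u) - kap.
    have := V_energy cx (sx (u + lag)) u0 (t := u + lag) (eta := eta / 2).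
    rewrite [u + lag - u]addrC addKr; apply => //.
    - by rewrite lerDl ltW.
    - by rewrite divr_ge0// ltW.
    move=> v hv; apply: le_trans (enorm_ge_norm _).
    have uv : u <= v by case/andP: hv.
    have h3 := dLip u v u0 uv.
    have h4 : M * (v - u) <= eta / 2.
      by rewrite mulrC -ler_pdivlMr// -/lag; lra_from hv.
    have := ler_distD (nD x v) (nD x u) 0; rewrite !subr0 (distrC (nD x u)) =>
      h5.
    by lra_from h3 h4 h5 etau.
  have h3 : V (sg x u) <= V (sg x a).
    by apply: (V_nonincreasing cx (sx u) a0 _ (lexx u)); case/andP: hu.
  have h4 := IH (ltnW im).
  by rewrite -natr1 mulrDl mul1r; lra_from h1 h2 h3 h4.
have h1 := dec m (leqnn m).
have h2 : V (sg x 0) <= alpha2 (N * c).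
  by apply: (V_seg_le cx (ltW c0)) => u; rewrite sub0r; exact: hx.
have h3 := V_ge0 (sg x (m%:R * (W + lag))).
by lra_from h1 h2 h3 hm.
Qed.

Let enorm_lt (v : 'cV[R]_n) e : `|v| < e / N -> enorm v < e.
Proof.
move=> h; apply: (@le_lt_trans _ _ (N * `|v|)).
  by apply: le_trans (enorm_le_norm _) _; rewrite ler_wpM2r// lerDl.
by rewrite mulrC -ltr_pdivlMr.
Qed.

Lemma solution_satisfies_of_rsol c (P : R -> R -> Prop) : 0 < c ->
  (forall x, continuous x -> (forall b, rsol f x b) ->
    (forall u, - Delta <= u <= 0 -> `|x u| <= c) ->
    forall t, 0 <= t -> P t (enorm (x t))) ->
  forall xi : H, supnorm Delta xi <= c -> solution_satisfies A delay f xi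
    (fun x => forall t, 0 <= t -> P t (enorm (x t))).
Proof.
have D0 := Delta_gt0; move=> c0 hP xi hxi.
have bxi := bnd_le hxi (bnd_supnorm_hist _ Delta_gt0); split.
  by have [K _ [+ _]] := global_existence_bound c0; exact.
move=> x /(rsol_of_global_solution Delta_gt0 delayP)[cx exi sx] t t0.
rewrite -(@clamp_leftE _ _ Delta x t); last by lra_from t0 D0.
by apply: hP => // u hu; rewrite exi//; exact: bxi.
Qed.

Lemma zero_GAS_of_functional : zero_GAS A delay f.
Proof.
have D0 := Delta_gt0; split.
- move=> e e0; have [d d0 hd] := local_stability (divr_gt0 e0 N_gt0).
  exists d => //; apply: (solution_satisfies_of_rsol (P := fun _ v => v < e)
    d0).
  by move=> x cx sx hx t t0; apply/enorm_lt/(hd x t) => //; rewrite t0 lexx.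
- move=> M; have c0 : 0 < Num.max M 1 by rewrite lt_max ltr01 orbT.
  have [K K0 [_ hK]] := global_existence_bound c0.
  exists (N * (K + 1)); first by rewrite mulr_gt0//; lra_from K0.
  move=> e eK; exists (Num.max M 1); first by rewrite le_max lexx.
  apply: (solution_satisfies_of_rsol (P := fun _ v => v < e) c0).
  move=> x cx sx hx t t0; apply/enorm_lt; rewrite ltr_pdivlMr//.
  apply: lt_le_trans eK; rewrite mulrC ltr_pM2l//.
  apply: (@le_lt_trans _ _ K); last by rewrite ltrDl.
  by apply: (hK x t) => //; lra_from t0 D0.
- move=> c e c0 e0; have [T T0 hT] := uniform_attraction c0 (divr_gt0 e0 N_gt0).
  exists T => // xi hxi.
  have [ex sat] := solution_satisfies_of_rsol (P := fun t v => T <= t -> v < e)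
    c0 (fun x cx sx hx t _ Tt => enorm_lt (hT x cx sx hx t Tt)) hxi.
  by split=> // x sx t Tt; apply: sat => //; lra_from Tt T0.
Qed.

End sufficiency.

(** * Necessity *)

Lemma within_continuous_of_lipschitz (R : realType) (g : R -> R) :
  (forall c, 0 < c -> exists2 L, 0 < L &
     forall s t, 0 <= s <= t -> t <= c -> `|g s - g t| <= L * (t - s)) ->
  {within `[0, +oo[, continuous g}.
Proof.
move=> hg; apply/subspace_continuousP => t; rewrite /= in_itv/= andbT => t0.
have [L L0 hL] := hg (t + 1) ltac:(lra).
apply/cvgrPdist_le => e e0; rewrite /from_subspace.
apply/nbhs_ballP; exists (Num.min 1 (e / L)) => [|s];
  first by rewrite /= lt_min ltr01 divr_gt0.
rewrite /ball/= lt_min => /andP[s1 se]; rewrite in_itv/= andbT => s0.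
have Le : L * `|t - s| <= e by rewrite mulrC -ler_pdivlMr// ltW.
apply: le_trans Le; have [st|ts] := leP s t.
  rewrite distrC [`|t - s|]ger0_norm ?subr_ge0//.
  by apply: hL; [rewrite s0|rewrite lerDl].
rewrite [`|t - s|]distrC [`|s - t|]ger0_norm ?subr_ge0 ?(ltW ts)//.
apply: hL; first by rewrite t0 ltW.
by move: s1; rewrite distrC ltr_norml => /andP[_]; lra.
Qed.

(** * The lower comparison function *)

Section excess.
Variables (R : realType).
Implicit Types (v w : R) (k : nat).

Definition excess k v : R := Num.max 0 (v - k.+1%:R^-1).

Lemma excess_ge0 k v : 0 <= excess k v.
Proof. by rewrite le_max lexx. Qed.

Lemma excess_lip k v w : excess k v <= excess k w + `|v - w|.
Proof.
rewrite /excess; set d := k.+1%:R^-1; clearbody d; rewrite ge_max.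
rewrite addr_ge0 ?le_max ?lexx//=; have h : v - w <= `|v - w| by exact:
  ler_norm.
have h' : w - d <= Num.max 0 (w - d) by rewrite le_max lexx orbT.
lra.
Qed.

Lemma excess_small k v : v <= k.+1%:R^-1 -> excess k v = 0.
Proof. by move=> h; rewrite /excess max_l// subr_le0. Qed.

Lemma excess_le k v : 0 <= v -> excess k v <= v.
Proof. by move=> v0; rewrite /excess ge_max v0/= gerBl ltW. Qed.

Lemma excess_mono k v w : v <= w -> excess k v <= excess k w.
Proof.
move=> vw; rewrite /excess ge_max le_max lexx/= le_max.
by rewrite lerD2r vw orbT.
Qed.

(** Convexity together with the value 0 at 0; it makes [sup_excess] strictly increasing. *)
Lemma excess_scale k c v : 0 <= c <= 1 -> excess k (c * v) <= c * excess k v.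
Proof.
move=> /andP[c0 c1]; rewrite /excess ge_max mulr_ge0 ?le_max ?lexx//=.
apply: (@le_trans _ _ (c * (v - k.+1%:R^-1))).
  by rewrite mulrBr lerD2l lerN2 ler_piMl// ltW.
by rewrite ler_wpM2l// le_max lexx orbT.
Qed.

Lemma excess_gt0 v : 0 < v -> exists k, 0 < excess k v.
Proof.
move=> v0; exists (Num.truncn v^-1); rewrite lt_max ltxx/= subr_gt0.
rewrite -[ltRHS]invrK ltf_pV2 ?posrE ?invr_gt0//.
exact: truncnS_gt.
Qed.

End excess.

(* In the application, [w k] is the weight [c_k] multiplied by [expR (- Delta)]. *)
Section lower_bound.
Variables (R : realType) (w : nat -> R).
Hypothesis w_gt0 : forall k, 0 < w k.
Hypothesis w_le1 : forall k, w k <= 1.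
Implicit Types v s t : R.

Definition sup_excess v : R := sup (range (fun k => w k * excess k v)).

Let has_sup_excess v : 0 <= v -> has_sup (range (fun k => w k * excess k v)).
Proof.
move=> v0; split; first by exists (w 0%N * excess 0 v), 0%N.
exists v => _ [k _ <-]; apply: le_trans (excess_le k v0).
by rewrite ler_piMl ?excess_ge0.
Qed.

Lemma sup_excess_ge v k : 0 <= v -> w k * excess k v <= sup_excess v.
Proof. by move=> v0; apply: ub_le_sup; [case: (has_sup_excess v0)|exists k].
  Qed.

Lemma sup_excess_le v c : (forall k, w k * excess k v <= c) -> sup_excess v <=
  c.
Proof.
by move=> h; apply: ge_sup => [|_ [k _ <-]//]; exists (w 0%N * excess 0 v), 0%N.
Qed.

Lemma sup_excess_ge0 v : 0 <= v -> 0 <= sup_excess v.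
Proof.
move=> v0; apply: le_trans (sup_excess_ge 0%N v0).
by rewrite mulr_ge0 ?excess_ge0// ltW.
Qed.

Lemma sup_excess_gt0 v : 0 < v -> 0 < sup_excess v.
Proof.
move=> v0; have [k hk] := excess_gt0 v0.
by apply: lt_le_trans (sup_excess_ge k (ltW v0)); rewrite mulr_gt0.
Qed.

Lemma sup_excess0 : sup_excess 0 = 0.
Proof.
apply/eqP; rewrite eq_le sup_excess_ge0// andbT; apply: sup_excess_le => k.
by rewrite excess_small ?mulr0// invr_ge0.
Qed.

(** A supremum of functions that are only nondecreasing could have plateaus; here [sup_excess (c *
    s) <= s / t * sup_excess (c * t)] excludes them wherever the right side is positive. Continuity
    comes from the weights being at most 1, unboundedness from the term [k = 0]. *)
Lemma class_Kinf_sup_excess c : 0 < c -> class_Kinf (fun s => sup_excess (c *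
  s)).
Proof.
move=> c0; split; first split.
- by move=> s s0; apply: sup_excess_ge0; rewrite mulr_ge0// ltW.
- apply: within_continuous_of_lipschitz => b _;
    exists c => // s t /andP[s0 st] _.
  have h u v : 0 <= v -> sup_excess (c * u) <= sup_excess (c * v) + c * `|u -
    v|.
    move=> v0; apply: sup_excess_le => k.
    have cv0 : 0 <= c * v by rewrite mulr_ge0// ltW.
    apply: le_trans (lerD (sup_excess_ge k cv0) (lexx _)).
    apply: (@le_trans _ _ (w k * (excess k (c * v) + `|c * u - c * v|))).
      by rewrite ler_wpM2l ?(ltW (w_gt0 k))// excess_lip.
    rewrite mulrDr lerD2l -mulrBr normrM (gtr0_norm c0).
    by rewrite ler_piMl// mulr_ge0// ltW.
  have := h s t (le_trans s0 st); have := h t s s0.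
  rewrite (distrC s t) ger0_norm ?subr_ge0// ler_norml => h1 h2.
  by apply/andP; split; [move: h1|move: h2]; lra.
- by rewrite mulr0 sup_excess0.
- move=> s t s0 st; have t0 : 0 < t := le_lt_trans s0 st.
  have W0 : 0 < sup_excess (c * t) by apply: sup_excess_gt0; rewrite mulr_gt0.
  apply: (@le_lt_trans _ _ (s / t * sup_excess (c * t))); last first.
    by rewrite gtr_pMl// ltr_pdivrMr// mul1r.
  apply: sup_excess_le => k.
  have st1 : 0 <= s / t <= 1 by rewrite divr_ge0 ?(ltW t0)// ler_pdivrMr// mul1r
    ltW.
  have -> : c * s = s / t * (c * t) by rewrite mulrCA divfK// gt_eqF.
  apply: (@le_trans _ _ (w k * (s / t * excess k (c * t)))).
    by rewrite ler_wpM2l ?(ltW (w_gt0 k))// excess_scale.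
  rewrite mulrCA ler_wpM2l//; first by case/andP: st1.
  by apply: sup_excess_ge; rewrite mulr_ge0// ltW.
(* Chosen so that [w 0 * (c * s - 1) = |M| + w 0]. *)
- move=> M; pose s := (`|M| / w 0%N + 2) / c.
  have s0 : 0 <= s by rewrite /s divr_ge0 ?(ltW c0)// addr_ge0// divr_ge0// ltW.
  exists s => //; apply: lt_le_trans (sup_excess_ge 0%N (mulr_ge0 (ltW c0) s0)).
  apply: le_lt_trans (ler_norm M) _; rewrite mulrC -ltr_pdivrMr//.
  rewrite lt_max; apply/orP; right.
  by rewrite /s [c * _]mulrC divfK ?gt_eqF// invr1; lra.
Qed.

End lower_bound.

(** * The converse functional *)

Section converse.
Variables (R : realType) (n p : nat) (Delta : R).
Variables (A : 'I_p -> 'M[R]_n) (delay : 'I_p -> R).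
Hypothesis Delta_gt0 : 0 < Delta.
Hypothesis delayP : forall j, 0 < delay j <= Delta.
Local Notation H := (hist n Delta).
Variable f : H -> 'cV[R]_n.
Hypothesis f_lip : lip_bounded f.
Hypothesis f0 : f (hist0 n Delta) = 0.
Local Notation sg := (seg Delta).
Local Notation nD := (neutral_diff A delay).
Local Notation rsol := (right_solution A delay).
Implicit Types (x y : R -> 'cV[R]_n) (phi psi : H).
Variable X : H -> R -> 'cV[R]_n.
Hypothesis X_continuous : forall phi, continuous (X phi).
Hypothesis X_hist : forall phi t, - Delta <= t <= 0 -> X phi t = phi t.
Hypothesis X_rsol : forall phi b, rsol f (X phi) b.
Arguments X_continuous : clear implicits.
Arguments X_rsol : clear implicits.
Hypothesis X_bounded : forall c, 0 < c -> exists K : R, forall phi,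
  bnd Delta phi c -> forall t, - Delta <= t -> `|X phi t| <= K.
Hypothesis X_attracted : forall c e, 0 < c -> 0 < e -> exists T : R, forall phi,
  bnd Delta phi c -> forall t, T <= t -> `|X phi t| < e.
Local Tactic Notation "lra_from" ne_hyp_list(hs) :=
  (clear - Delta_gt0 delayP f_lip f0 X_continuous X_hist X_rsol X_bounded
    X_attracted hs); lra.

Lemma X_seg phi h t : 0 <= h -> - Delta <= t ->
  X (sg (X phi) h) t = X phi (t + h).
Proof.
move=> h0 tD; pose y u := X phi (u + h).
have cy : continuous y := continuous_translate (X_continuous phi).
have sy b : rsol f y b by exact: (rsol_shift (X_continuous phi) h0 (X_rsol _
  _)).
have hy u : - Delta <= u <= 0 -> X (sg (X phi) h) u = y u.
  by move=> hu; rewrite X_hist// (sgE _ (X_continuous phi) hu) addrC.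
exact: (rsol_unique Delta_gt0 delayP f_lip (X_continuous _) cy (X_rsol _) sy hy
  tD).
Qed.

Lemma seg_X0 phi : sg (X phi) 0 = phi.
Proof.
apply: hist_ext => s; rewrite /= in_itv/= => hs.
by rewrite (sgE _ (X_continuous phi) hs) add0r X_hist.
Qed.

Lemma X_zero t : - Delta <= t -> X (hist0 n Delta) t = 0.
Proof.
have c0 : continuous (fun _ : R => 0 : 'cV[R]_n) by move=> ?; exact: cvg_cst.
have s0 b : rsol f (fun=> 0) b.
  move=> s hs e e0; exists 1 => // h /andP[h0 _].
  have -> : sg (fun=> 0) s = hist0 n Delta.
    by apply: hist_ext => u; rewrite /= in_itv/= => hu; rewrite (sgE _ c0 hu).
  have nD0 u : nD (fun=> 0) u = 0.
    by rewrite /neutral_diff big1 ?subr0// => j _; rewrite mulmx0.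
  by rewrite f0 scaler0 !nD0 !subrr normr0 mulr_ge0// ltW.
have h0 u : - Delta <= u <= 0 -> X (hist0 n Delta) u = 0 by move=> hu;
  rewrite X_hist.
move=> tD.
exact: (rsol_unique Delta_gt0 delayP f_lip (X_continuous _) c0 (X_rsol _) s0 h0
  tD).
Qed.

Definition weighted_excess k phi t : R := expR t * excess k `|X phi t|.

Lemma weighted_excess_ge0 k phi t : 0 <= weighted_excess k phi t.
Proof. by rewrite mulr_ge0 ?expR_ge0 ?excess_ge0. Qed.

(** Beyond [T] the left-hand side vanishes; before [T] the weight is at most [expR T]. The one-sided
    form is what passes to suprema. *)
Lemma weighted_excess_lip k c : 0 < c -> exists M, 0 <= M /\
  forall phi psi q, bnd Delta phi c -> bnd Delta psi c ->
    bnd Delta (phi \- psi) q -> forall t, - Delta <= t ->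
  weighted_excess k phi t <= weighted_excess k psi t + M * q.
Proof.
have D0 := Delta_gt0; move=> c0; have [K hK] := X_bounded c0.
have k0 : 0 < k.+1%:R^-1 :> R by rewrite invr_gt0.
have [T hT] := X_attracted c0 k0.
have [C C0 hC] := lipschitz_dependence A Delta_gt0 delayP K T f_lip.
exists (expR T * C); split; first by rewrite mulr_ge0 ?expR_ge0// ltW.
move=> phi psi q hphi hpsi hq t tD.
have q0 : 0 <= q := bnd_ge0 Delta_gt0 hq.
have [Tt|tT] := leP T t.
  rewrite {1}/weighted_excess excess_small ?mulr0; last exact/ltW/hT.
  by rewrite addr_ge0 ?weighted_excess_ge0// !mulr_ge0// ?expR_ge0// ltW.
have hXY : `|X phi t - X psi t| <= C * q.
  apply: (hC _ _ q (X_continuous _) (X_continuous _) (X_rsol _ _) (X_rsol _ _)).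
  - by move=> u /andP[uD _]; exact: hK.
  - by move=> u /andP[uD _]; exact: hK.
  - by move=> u hu; rewrite !X_hist//; exact: hq.
  - by rewrite tD ltW.
rewrite /weighted_excess; apply: le_trans (_ : _ <= expR t *
  (excess k `|X psi t| + C * q)) _.
  rewrite ler_wpM2l ?expR_ge0//.
  apply: le_trans (excess_lip _ _ `|X psi t|) _; rewrite lerD2l.
  exact: le_trans (ler_dist_dist _ _) hXY.
rewrite mulrDr lerD2l -mulrA ler_wpM2r ?mulr_ge0 ?(ltW C0)//.
by rewrite ler_expR ltW.
Qed.

Variable M : nat -> nat -> R.
Hypothesis M_ge0 : forall k m, 0 <= M k m.
Hypothesis M_lip : forall k m phi psi q, bnd Delta phi m.+1%:R ->
  bnd Delta psi m.+1%:R -> bnd Delta (phi \- psi) q -> forall t, - Delta <= t ->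
  weighted_excess k phi t <= weighted_excess k psi t + M k m * q.

Local Tactic Notation "lra_from" ne_hyp_list(hs) :=
  (clear - Delta_gt0 delayP f_lip f0 X_continuous X_hist X_rsol X_bounded
    X_attracted M_ge0 M_lip hs); lra.

(* Makes the [k]-th term 1-Lipschitz on the ball of radius [k + 1]. *)
Definition weight k : R := (1 + M k k)^-1.

Lemma weight_gt0 k : 0 < weight k.
Proof. by rewrite invr_gt0 ltr_wpDr. Qed.

Lemma weight_le1 k : weight k <= 1.
Proof. by rewrite invf_le1 ?lerDl// ltr_wpDr. Qed.

(** On the ball of radius [m + 1] the weights already make the terms with [k >= m] 1-Lipschitz; the
    finitely many others contribute their own constants. *)
Definition lip_const m : R := 1 + \sum_(k < m) M k m.

Lemma lip_const_gt0 m : 0 < lip_const m.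
Proof. by rewrite ltr_wpDr// sumr_ge0. Qed.

Lemma weighted_excess_lip_const k m phi psi q : bnd Delta phi m.+1%:R ->
  bnd Delta psi m.+1%:R -> bnd Delta (phi \- psi) q -> forall t, - Delta <= t ->
  weight k * weighted_excess k phi t <=
  weight k * weighted_excess k psi t + lip_const m * q.
Proof.
move=> hphi hpsi hq t tD; have q0 : 0 <= q := bnd_ge0 Delta_gt0 hq.
have w0 := weight_gt0 k; have w1 := weight_le1 k.
have S0 : 0 <= \sum_(k < m) M k m by exact: sumr_ge0.
suff [M' [M'0 M'L h]] : exists M', [/\ 0 <= M', weight k * M' <= lip_const m &
    weighted_excess k phi t <= weighted_excess k psi t + M' * q].
  have := ler_wpM2l (ltW w0) h; rewrite mulrDr (mulrA _ M') => h'.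
  by apply: le_trans h' _; rewrite lerD2l ler_wpM2r.
have [km|mk] := ltnP k m.
  exists (M k m); split=> //; last exact: M_lip.
  apply: (@le_trans _ _ (M k m)); first by rewrite ler_piMl.
  rewrite /lip_const (bigD1 (Ordinal km))//= addrCA lerDl addr_ge0// sumr_ge0//.
exists (M k k); split=> //.
  apply: (@le_trans _ _ 1); last by rewrite /lip_const lerDl.
  by rewrite /weight mulrC ler_pdivrMr ?mul1r ?lerDr// ltr_wpDr.
have mk' : m.+1%:R <= k.+1%:R :> R by rewrite ler_nat.
by apply: M_lip => //; [exact: bnd_le hphi|exact: bnd_le hpsi].
Qed.

Definition lyap_values phi : set R :=
  [set v | exists k t, - Delta <= t /\ v = weight k * weighted_excess k phi t].

Definition lyap phi : R := sup (lyap_values phi).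

Lemma bnd_nat phi : exists m : nat, bnd Delta phi m%:R.
Proof.
have [c c0 hc] := hist_bnd Delta_gt0 phi; exists (Num.truncn c).+1.
by apply: bnd_le hc; exact/ltW/truncnS_gt.
Qed.

Lemma lyap_values_neq0 phi : lyap_values phi !=set0.
Proof.
exists (weight 0 * weighted_excess 0 phi 0), 0%N, 0; split=> //.
by rewrite lerNl oppr0 ltW.
Qed.

Lemma bnd_hist0 c : 0 <= c -> bnd Delta (hist0 n Delta) c.
Proof. by move=> c0 s _; rewrite normr0. Qed.

Lemma weighted_excess_zero k t : - Delta <= t ->
  weighted_excess k (hist0 n Delta) t = 0.
Proof.
by move=> tD; rewrite /weighted_excess X_zero// normr0 excess_small ?mulr0.
Qed.

Lemma weighted_excess_le m phi q k t : bnd Delta phi m.+1%:R -> bnd Delta phi q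
  ->
  - Delta <= t -> weight k * weighted_excess k phi t <= lip_const m * q.
Proof.
move=> hphi hq tD.
have := @weighted_excess_lip_const k m phi (hist0 n Delta) q hphi (bnd_hist0
  (ler0n _ _)).
have hq' : bnd Delta (phi \- hist0 n Delta) q.
  by move=> s hs; rewrite /= subr0; exact: hq.
by move=> /(_ hq' t tD); rewrite weighted_excess_zero// mulr0 add0r.
Qed.

Lemma lyap_has_sup phi : has_sup (lyap_values phi).
Proof.
split; first exact: lyap_values_neq0.
have [m hm] := bnd_nat phi.
have hm' : bnd Delta phi m.+1%:R by apply: bnd_le hm; rewrite ler_nat.
exists (lip_const m * m%:R) => _ [k [t [tD ->]]].
exact: weighted_excess_le.
Qed.

Lemma lyap_ge phi k t : - Delta <= t ->
  weight k * weighted_excess k phi t <= lyap phi.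
Proof.
by move=> tD; apply: ub_le_sup; [case: (lyap_has_sup phi)|exists k, t].
Qed.

Lemma lyap_le phi c : (forall k t, - Delta <= t ->
  weight k * weighted_excess k phi t <= c) -> lyap phi <= c.
Proof.
move=> h; apply: ge_sup; first exact: lyap_values_neq0.
by move=> _ [k [t [tD ->]]]; exact: h.
Qed.

Lemma lyap_ge0 phi : 0 <= lyap phi.
Proof.
have D0 : - Delta <= 0 by rewrite lerNl oppr0 ltW.
apply: le_trans (lyap_ge phi 0%N D0).
by rewrite mulr_ge0 ?weighted_excess_ge0// ltW ?weight_gt0.
Qed.

Lemma lyap_lip m phi psi q : bnd Delta phi m.+1%:R -> bnd Delta psi m.+1%:R ->
  bnd Delta (phi \- psi) q -> `|lyap phi - lyap psi| <= lip_const m * q.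
Proof.
have key phi' psi' : bnd Delta phi' m.+1%:R -> bnd Delta psi' m.+1%:R ->
    bnd Delta (phi' \- psi') q -> lyap phi' <= lyap psi' + lip_const m * q.
  move=> h1 h2 h12; apply: lyap_le => k t tD.
  apply: le_trans (weighted_excess_lip_const k h1 h2 h12 tD) _.
  by rewrite lerD2r lyap_ge.
move=> h1 h2 h12; have k1 := key _ _ h1 h2 h12.
by have := key _ _ h2 h1 (bnd_subC h12); rewrite ler_norml; move: k1; lra.
Qed.

(** By the flow property [X_seg], shifting the trajectory only drops initial times from the
    supremum, and [expR t = expR (- h) * expR (t + h)]. *)
Lemma lyap_decay phi h : 0 <= h -> lyap (sg (X phi) h) <= expR (- h) * lyap phi.
Proof.
move=> h0; apply: lyap_le => k t tD.
have thD : - Delta <= t + h by rewrite (le_trans tD)// lerDl.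
rewrite /weighted_excess X_seg// (_ : expR t = expR (- h) * expR (t + h));
  last first.
  by rewrite -expRD addrCA addNr addr0.
rewrite -mulrA mulrCA ler_wpM2l ?expR_ge0//; exact: lyap_ge.
Qed.

Lemma lyap_locally_lipschitz : locally_lipschitz lyap.
Proof.
move=> phi; have [m hm] := bnd_nat phi.
exists 1, (lip_const m); split=> //; first exact: lip_const_gt0.
have hb psi : supnorm Delta (psi \- phi) <= 1 -> bnd Delta psi m.+1%:R.
  move=> h s hs; have := bnd_supnorm Delta_gt0 psi phi hs => /= h1.
  have h2 := hm s hs; have h3 := ler_distD (phi s) (psi s) 0.
  by rewrite !subr0 in h3; rewrite -natr1; lra_from h h1 h2 h3.
move=> phi1 phi2 h1 h2; apply: lyap_lip; [exact: hb|exact: hb|exact: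
  bnd_supnorm].
Qed.

Lemma expRN_le (h : R) : 0 <= h -> expR (- h) <= 1 - h + h ^+ 2.
Proof.
move=> h0; have h1 : 0 < 1 + h by lra.
rewrite expRN; apply: (@le_trans _ _ (1 + h)^-1).
  by rewrite lef_pV2 ?posrE ?expR_gt0 ?expR_ge1Dx.
rewrite -[_^-1]mul1r ler_pdivrMr//.
have -> : (1 - h + h ^+ 2) * (1 + h) = 1 + h ^+ 3 by ring.
by rewrite lerDl exprn_ge0.
Qed.

(** The shift is exchanged for the true segment at cost [e / 2 * h]; then [lyap_decay] with
    [expR (- h) <= 1 - h + h ^+ 2] leaves a term [h ^+ 2 * v], below [e / 2 * h] by the choice of
    [d4]. The bounds [d2] and [d3] keep segment and shift in the ball of radius [m + 1]. *)
Lemma lyap_derivative phi :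
  (upper_derivative A delay f lyap phi <= (- lyap phi)%:E)%E.
Proof.
apply: limf_esup_right_le => e e0.
have [m hm] := bnd_nat phi; set L := lip_const m.
have L0 : 0 < L := lip_const_gt0 m.
have V0 := lyap_ge0 phi; set v := lyap phi in V0 *.
pose e1 := e / 2 / L; have e10 : 0 < e1 by rewrite !divr_gt0.
have h01 : 0 <= (0 : R) < 1 by rewrite lexx ltr01.
have [d1 d10 hd1] := seg_sub_neutral_shift Delta_gt0 delayP (X_continuous phi)
  (X_rsol phi 1) h01 e10.
have [d2 d20 hd2] := sg_continuous Delta 0 (X_continuous phi) (ltac:(lra_from
  e0) : 0 < 2^-1 :> R).
pose d3 := 2^-1 / e1; have d30 : 0 < d3 by rewrite divr_gt0.
pose d4 := e / 2 / (v + 1); have v1 : 0 < v + 1 by lra_from V0.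
have d40 : 0 < d4 by rewrite !divr_gt0.
exists (Num.min (Num.min d1 d2) (Num.min d3 d4)).
  by rewrite !lt_min d10 d20 d30 d40.
move=> h /andP[h0]; rewrite !lt_min => /andP[/andP[hh1 hh2] /andP[hh3 hh4]].
have b1 := hd1 h ltac:(by rewrite h0); have b2 := hd2 h.
rewrite add0r seg_X0 in b1; rewrite subr0 gtr0_norm// seg_X0 in b2.
have {}b2 := b2 hh2.
have e1h : e1 * h <= 2^-1 by rewrite mulrC -ler_pdivlMr// ltW.
set ns := neutral_shift A delay f phi h in b1 *; clearbody ns.
have hS : bnd Delta (sg (X phi) h) m.+1%:R.
  move=> s hs; have := b2 s hs; have := hm s hs; rewrite /= -[m.+1%:R]natr1.
  have := ler_distD (phi s) (sg (X phi) h s) 0; rewrite !subr0 => k1 k2 k3.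
  by lra_from k1 k2 k3.
have hN : bnd Delta ns m.+1%:R.
  move=> s hs; have := b1 s hs; have := b2 s hs; have := hm s hs;
    rewrite /= -[m.+1%:R]natr1.
  have := ler_distD (phi s) (sg (X phi) h s) 0;
    have := ler_distD (sg (X phi) h s) (ns s) 0.
  rewrite !subr0 (distrC (ns s)) => k1 k2 k3 k4 k5.
  have := ler_distD (phi s) (sg (X phi) h s) 0; rewrite !subr0 => k6.
  by lra_from k1 k2 k3 k4 k5 k6 e1h.
have := lyap_lip hS hN b1; rewrite mulrA -/L.
rewrite (_ : L * e1 = e / 2); last by rewrite /e1 mulrC divfK// gt_eqF.
rewrite ler_norml => /andP[k1 _].
have k2 := le_trans (lyap_decay phi (ltW h0)) (ler_wpM2r V0 (expRN_le (ltW
  h0))).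
have k3 : h * v <= e / 2.
  apply: (@le_trans _ _ (h * (v + 1))); first by rewrite ler_wpM2l ?(ltW h0)//
    lerDl.
  by rewrite -ler_pdivlMr// ltW.
have k4 := ler_wpM2l (ltW h0) k3.
rewrite ler_pdivrMr//; move: k1 k2; rewrite -/v.
set a := lyap ns; set b := lyap _; rewrite expr2 => k1 k2.
by lra_from k1 k2 k4.
Qed.

Definition hist_scale (a : R) phi : H :=
  sg (fun t => a *: phi (Num.max (- Delta) (Num.min t 0))) 0.

Lemma hist_scaleE a phi s : - Delta <= s <= 0 -> hist_scale a phi s = a *: phi
  s.
Proof.
have c : continuous (fun t : R => a *: phi (Num.max (- Delta) (Num.min t 0))).
  by move=> t; apply: cvgZl_tmp; exact: hist_clamp_continuous.
move=> hs; rewrite (sgE _ c hs) add0r min_l ?max_r//; by case/andP: hs.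
Qed.

Definition lyap_max (s : R) : R := sup [set lyap phi | phi in [set phi : H | bnd
  Delta phi s]].

Lemma lyap_max_has_sup s : 0 <= s ->
  has_sup [set lyap phi | phi in [set phi : H | bnd Delta phi s]].
Proof.
move=> s0; split; first by exists (lyap (hist0 n Delta)), (hist0 n Delta) => //;
  exact: bnd_hist0.
pose m := Num.truncn s; exists (lip_const m * s) => _ [phi /= hphi <-].
apply: lyap_le => k t tD; apply: weighted_excess_le => //.
by apply: bnd_le hphi; exact/ltW/truncnS_gt.
Qed.

Lemma lyap_max_ge s phi : bnd Delta phi s -> lyap phi <= lyap_max s.
Proof.
move=> hphi; have s0 := bnd_ge0 Delta_gt0 hphi.
by apply: ub_le_sup; [case: (lyap_max_has_sup s0)|exists phi].
Qed.

Lemma lyap_max_le s c : 0 <= s -> (forall phi, bnd Delta phi s -> lyap phi <= c)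
  ->
  lyap_max s <= c.
Proof.
move=> s0 h; apply: ge_sup; first by case: (lyap_max_has_sup s0).
by move=> _ [phi /= hphi <-]; exact: h.
Qed.

(** The summand [s] supplies strict growth and unboundedness. For continuity, scaling by [s / t]
    moves the ball of radius [t] into that of radius [s] by a distance at most [t - s]. *)
Lemma class_Kinf_lyap_max : class_Kinf (fun s => s + lyap_max s).
Proof.
have pos s : 0 <= s -> 0 <= lyap_max s.
  by move=> s0; apply: le_trans (lyap_max_ge (bnd_hist0 s0)); exact: lyap_ge0.
have mono s t : 0 <= s <= t -> lyap_max s <= lyap_max t.
  move=> /andP[s0 st]; apply: lyap_max_le => // phi hphi; apply: lyap_max_ge.
  exact: bnd_le hphi.
split; first split.
- by move=> s s0; rewrite addr_ge0// pos.
- apply: within_continuous_of_lipschitz => c c0.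
  pose m := Num.truncn c; exists (1 + lip_const m).
    by rewrite addr_gt0// lip_const_gt0.
  move=> s t /andP[s0 st] tc.
  have h1 := mono s t ltac:(by rewrite s0).
  have h2 : lyap_max t <= lyap_max s + lip_const m * (t - s).
    apply: lyap_max_le => [|phi hphi]; first exact: le_trans s0 st.
    have [t0|t0] := leP t 0.
      have e : t = s by lra_from t0 st s0.
      by rewrite e subrr mulr0 addr0; apply: lyap_max_ge; rewrite -e.
    pose psi := hist_scale (s / t) phi.
    have r1 : s / t <= 1 by rewrite ler_pdivrMr// mul1r.
    have r0 : 0 <= s / t by rewrite divr_ge0// ltW.
    have hpsi : bnd Delta psi s.
      move=> u hu; rewrite hist_scaleE// normrZ ger0_norm//.
      by apply: le_trans (ler_wpM2l r0 (hphi u hu)) _; rewrite divfK// gt_eqF.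
    have hd : bnd Delta (phi \- psi) (t - s).
      move=> u hu; rewrite /= hist_scaleE// -{1}[phi u]scale1r -scalerBl normrZ.
      rewrite ger0_norm ?subr_ge0//.
      have r2 : 0 <= 1 - s / t by rewrite subr_ge0.
      apply: le_trans (ler_wpM2l r2 (hphi u hu)) _.
      by rewrite mulrBl mul1r divfK// gt_eqF.
    have cm : c <= m.+1%:R by exact/ltW/truncnS_gt.
    have := lyap_lip (bnd_le (le_trans tc cm) hphi)
      (bnd_le (le_trans st (le_trans tc cm)) hpsi) hd.
    rewrite ler_norml => /andP[_ h3]; have h4 := lyap_max_ge hpsi.
    by lra_from h3 h4.
  rewrite distrC ger0_norm; lra_from st h1 h2.
- have : lyap_max 0 <= 0.
    apply: lyap_max_le => // phi hphi; apply: lyap_le => k t tD.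
    rewrite -(mulr0 (lip_const 0)); apply: weighted_excess_le => //.
    by apply: bnd_le hphi; exact: ler0n.
  by have := pos 0 (lexx 0) => h1 h2; apply/eqP; rewrite add0r eq_le h1 h2.
- by move=> s t s0 st; rewrite ltr_leD// mono// s0 ltW.
- move=> c; exists (`|c| + 1); first by rewrite addr_ge0.
  have := pos (`|c| + 1) ltac:(by rewrite addr_ge0); have := ler_norm c.
  by move=> h1 h2; lra_from h1 h2.
Qed.

(** The times in [[- Delta, 0]] bound each [sup_excess |phi s|], with [expR (- Delta)] the least
    weight there. If the claim failed, monotonicity would give [|phi s| <= q] for all [s], hence
    [E <= (K - 1) * q], whereas [E = K * q]. So [q = 0], where [sup_excess] is 0, against
    [lyap_ge0]. The [+ 1] in [K] is what forces [q = 0]. *)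
Lemma lyap_lower a phi : 0 <= a ->
  (forall (v : 'I_p -> 'cV[R]_n) c,
    (forall j, `|v j| <= c) -> 0 <= c -> `|\sum_(j < p) A j *m v j| <= a * c) ->
  sup_excess (fun k => weight k * expR (- Delta))
    ((Num.sqrt n%:R * (1 + a) + 1)^-1 * enorm (neutral_op A delay phi)) <= lyap
      phi.
Proof.
have D0 := Delta_gt0; move=> a0 aP; set K := _ + 1.
have K1 : 0 <= Num.sqrt (n%:R : R) * (1 + a).
  by rewrite mulr_ge0 ?sqrtr_ge0//; lra_from a0.
have K0 : 0 < K by rewrite ltr_wpDl.
set E := enorm _; set q := _ * _.
have E0 : 0 <= E by exact: sqrtr_ge0.
have q0 : 0 <= q by rewrite mulr_ge0// invr_ge0 ltW.
have Eq : E = K * q by rewrite /q mulrA divff ?mul1r// gt_eqF.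
have e1 : expR (- Delta) <= 1 by rewrite -expR0 ler_expR; lra_from D0.
have w0 k : 0 < weight k * expR (- Delta) by rewrite mulr_gt0 ?weight_gt0
  ?expR_gt0.
have w1 k : weight k * expR (- Delta) <= 1.
  by rewrite mulr_ile1 ?expR_ge0 ?weight_le1// ltW ?weight_gt0.
have lower s : - Delta <= s <= 0 -> sup_excess (fun k => weight k * expR (-
  Delta))
    `|phi s| <= lyap phi.
  move=> hs; have /andP[sD _] := hs; apply: sup_excess_le => k.
  apply: le_trans (lyap_ge phi k sD); rewrite -mulrA ler_wpM2l ?(ltW (weight_gt0
    k))//.
  by rewrite /weighted_excess X_hist// ler_wpM2r ?excess_ge0// ler_expR.
rewrite leNgt; apply/negP => hlt.
have hb : bnd Delta phi q.
  move=> s hs; rewrite leNgt; apply/negP => qs.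
  have := le_lt_trans (lower s hs) hlt; rewrite ltNge => /negP; apply.
  apply: sup_excess_le => k.
  apply: le_trans (@sup_excess_ge _ (fun k => weight k * expR (- Delta))
    w1 _ k (normr_ge0 (phi s))).
  by rewrite ler_wpM2l ?(ltW (w0 k))// excess_mono// ltW.
have hD : `|neutral_op A delay phi| <= (1 + a) * q.
  rewrite mulrDl mul1r; apply: le_trans (ler_normB _ _) _; apply: lerD.
    by apply: hb; lra_from D0.
  by apply: aP => // j; apply: hb; have dj := delayP j; lra_from dj.
have hE : E <= Num.sqrt (n%:R : R) * (1 + a) * q.
  apply: le_trans (enorm_le_norm _) _.
  by rewrite -mulrA ler_wpM2l ?sqrtr_ge0.
have q00 : q = 0.
  have : K * q <= Num.sqrt (n%:R : R) * (1 + a) * q by rewrite -Eq.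
  by rewrite /K mulrDl mul1r => h; lra_from h q0.
by move: hlt; rewrite q00 sup_excess0// ltNge lyap_ge0.
Qed.

End converse.

(** The rate is [alpha1] again, because D^+V <= - V and [V] dominates [alpha1] of the neutral
    operator. *)
Lemma functional_of_zero_GAS (R : realType) (n p : nat) (Delta : R)
    (A : 'I_p -> 'M[R]_n) (delay : 'I_p -> R) (f : hist n Delta -> 'cV[R]_n) :
  0 < Delta -> (forall j, 0 < delay j <= Delta) -> lip_bounded f ->
  f (hist0 n Delta) = 0 -> zero_GAS A delay f ->
  exists (V : hist n Delta -> R) (alpha1 alpha2 : R -> R),
    [/\ forall phi, 0 <= V phi, locally_lipschitz V, class_Kinf alpha1,
      class_Kinf alpha2 & forall phi,
      [/\ alpha1 (enorm (neutral_op A delay phi)) <= V phi,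
        V phi <= alpha2 (supnorm Delta phi) &
        (upper_derivative A delay f V phi <=
          (- alpha1 (enorm (neutral_op A delay phi)))%:E)%E]].
Proof.
move=> D0 delayP f_lip f0 [_ large attr].
have N0 : 0 < Num.sqrt (n%:R : R) + 1 by rewrite ltr_wpDl ?sqrtr_ge0.
have supN c (phi : hist n Delta) : 0 < c -> bnd Delta phi c ->
    supnorm Delta phi <= (Num.sqrt n%:R + 1) * c.
  move=> c0 hphi; apply: le_trans (supnorm_le_bnd (ltW D0) hphi) _.
  by rewrite ler_pM2r// lerDl.
(* The clause that [delta] may be arbitrarily large gives a solution from every initial function
   here, and uniform bounds on balls in [X_bounded]. *)
have /choice[X XP] : forall phi : hist n Delta, exists x : R -> 'cV[R]_n,
    [/\ continuous x, forall t, - Delta <= t <= 0 -> x t = phi t &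
      forall b, right_solution A delay f x b].
  move=> phi; have [e0 e00 he0] := large (supnorm Delta phi).
  have [d hd sol] := he0 e0 (lexx _); have [[x xsol] _] := sol phi hd.
  by exists (clamp_left Delta x); exact: (rsol_of_global_solution D0 delayP
    xsol).
have X_continuous phi : continuous (X phi) by case: (XP phi).
have X_hist phi : forall t, - Delta <= t <= 0 -> X phi t = phi t by case: (XP
  phi).
have X_rsol phi b : right_solution A delay f (X phi) b by case: (XP phi).
have X_sol phi : global_solution A delay f phi (X phi).
  exact: (global_solution_of_rsol D0 delayP f_lip (X_continuous phi) (X_hist
    phi) (X_rsol phi)).
have X_bounded c : 0 < c -> exists K : R, forall phi : hist n Delta,
    bnd Delta phi c -> forall t, - Delta <= t -> `|X phi t| <= K.
  move=> c0; have [e0 e00 he0] := large ((Num.sqrt n%:R + 1) * c).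
  have [d hd sol] := he0 e0 (lexx _); exists (e0 + c) => phi hphi t tD.
  have [t0|t0] := leP t 0.
    have ht : - Delta <= t <= 0 by rewrite tD t0.
    by rewrite X_hist//; have := hphi t ht; lra.
  have [_ sat] := sol phi (le_trans (supN c phi c0 hphi) hd).
  have h1 := sat _ (X_sol phi) t (ltW t0).
  by apply: le_trans (enorm_ge_norm _) _; rewrite (le_trans (ltW h1))// lerDl
    ltW.
have X_attracted c e : 0 < c -> 0 < e -> exists T : R, forall phi : hist n
  Delta,
    bnd Delta phi c -> forall t, T <= t -> `|X phi t| < e.
  move=> c0 e0; have [T T0 hT] := attr ((Num.sqrt n%:R + 1) * c) e (mulr_gt0 N0
    c0) e0.
  exists T => phi hphi t tT; have [_ sat] := hT phi (supN c phi c0 hphi).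
  exact: le_lt_trans (enorm_ge_norm _) (sat _ (X_sol phi) t tT).
have /choice[M MP] : forall km : nat * nat, exists M : R, 0 <= M /\
    forall (phi psi : hist n Delta) q,
    bnd Delta phi km.2.+1%:R -> bnd Delta psi km.2.+1%:R ->
    bnd Delta (phi \- psi) q -> forall t, - Delta <= t ->
    weighted_excess X km.1 phi t <= weighted_excess X km.1 psi t + M * q.
  move=> [k m] /=; exact: (weighted_excess_lip D0 delayP f_lip X_continuous
    X_hist X_rsol X_bounded X_attracted).
pose M' k m := M (k, m).
have M'0 k m : 0 <= M' k m by have [] := MP (k, m).
have M'lip k m := (MP (k, m)).2.
have [a a0 aP] := sum_mulmx_bound A.
have K0 : 0 < (Num.sqrt (n%:R : R) * (1 + a) + 1)^-1.
  by rewrite invr_gt0 ltr_wpDl// mulr_ge0 ?sqrtr_ge0// addr_ge0.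
exists (lyap X M'), (fun s => sup_excess (fun k => weight M' k * expR (- Delta))
  ((Num.sqrt n%:R * (1 + a) + 1)^-1 * s)), (fun s => s + lyap_max X M' s).
have lower phi := lyap_lower D0 delayP f_lip f0 X_continuous X_hist X_rsol
  M'0 M'lip phi a0 aP.
split=> [phi|||| phi].
- exact: (lyap_ge0 D0 delayP f_lip f0 X_continuous X_hist X_rsol M'0 M'lip).
- exact: (lyap_locally_lipschitz D0 delayP f_lip f0 X_continuous X_hist X_rsol
    M'0 M'lip).
- apply: class_Kinf_sup_excess => // k.
    by rewrite mulr_gt0 ?weight_gt0 ?expR_gt0.
  have e1 : expR (- Delta) <= 1 by rewrite -expR0 ler_expR; lra.
  by rewrite mulr_ile1 ?expR_ge0 ?weight_le1// ltW ?weight_gt0.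
- exact: (class_Kinf_lyap_max D0 delayP f_lip f0 X_continuous X_hist X_rsol M'0
    M'lip).
split; first exact: lower.
  have h := bnd_supnorm_hist phi D0.
  apply: (@le_trans _ _ (lyap_max X M' (supnorm Delta phi))).
    exact: (lyap_max_ge D0 delayP f_lip f0 X_continuous X_hist X_rsol M'0
      M'lip).
  by rewrite lerDr; exact: (bnd_ge0 D0 h).
apply: le_trans (lyap_derivative D0 delayP f_lip f0 X_continuous X_hist X_rsol
  M'0 M'lip phi) _.
by rewrite lee_fin lerN2; exact: lower.
Qed.

Theorem theorem1 (R : realType) (n p : nat) (hn : (0 < n)%N) (hp : (0 < p)%N)
    (Delta : R) (hDelta : 0 < Delta)
    (delay : 'I_p -> R) (hdelay : forall j, 0 < delay j <= Delta)
    (A : 'I_p -> 'M[R]_n) (f : hist n Delta -> 'cV[R]_n)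
    (hf : lipschitz_on_bounded_sets f) (hf0 : f (hist0 n Delta) = 0)
    (hA : strongly_stable A) :
  zero_GAS A delay f <->
  exists (V : hist n Delta -> R) (alpha1 alpha2 alpha3 : R -> R),
    [/\ (forall phi, 0 <= V phi) /\ locally_lipschitz V,
        class_Kinf alpha1 /\ class_Kinf alpha2,
        class_K alpha3 &
        forall phi : hist n Delta,
          (alpha1 (enorm (neutral_op A delay phi)) <= V phi
             <= alpha2 (supnorm Delta phi)) /\
          (upper_derivative A delay f V phi
             <= (- alpha3 (enorm (neutral_op A delay phi)))%:E)%E].
Proof.
have f_lip := lip_bounded_of_enorm hDelta hf.
split=> [gas|[V [alpha1 [alpha2 [alpha3 [[V0 Vlip] [K1 K2] K3 hV]]]]]].
  have [V [alpha1 [alpha2 [V0 Vlip K1 K2 hV]]]] :=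
    functional_of_zero_GAS hDelta hdelay f_lip hf0 gas.
  exists V, alpha1, alpha2, alpha1; split=> //; first by case: K1.
  by move=> phi; have [-> -> ->] := hV phi.
apply: (@zero_GAS_of_functional R n p Delta A delay hDelta hdelay f f_lip _
  V alpha1 alpha2 alpha3 V0 Vlip K1 K2 K3) => [|phi|phi|phi].
- by apply: hA => j; case/andP: (hdelay j).
- by have [/andP[]] := hV phi.
- by have [/andP[]] := hV phi.
- by have [] := hV phi.
Qed.
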